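(* Let $\varepsilon>0$ and let $f\in\mathbb{R}[p_2,p_3,\ldots]$ be a symmetric function such that $f^h(x_0,x)\geq\varepsilon$ for all $(x_0,x)\in\mathbb{R}\times\mathbb{R}^\infty$ with $x_0^2+p_2(x)=1$, where $f^h$ denotes the homogenization of $f$ with respect to the new variable $X_0$. Then there exists $k\in\mathbb{N}_0$ such that $(1+p_2)^k f$ is an any-dimensional sum of squares.
   Context: $\mathbb{N}$ denotes the positive integers and $\mathbb{N}_0=\mathbb{N}\cup\{0\}$. For $k\geq 1$ let $p_k=\sum_{i=1}^\infty X_i^k$ be the $k$-th power sum function in countably many variables $X_1,X_2,\ldots$; the $p_k$ are algebraically independent and $p_k$ has degree $k$ in the $X_i$. A symmetric function is an element of $\Lambda=\mathbb{R}[p_1,p_2,\ldots]$; it has bounded degree. If $f$ has degree $D$ with homogeneous components $f_0,\ldots,f_D$ (with respect to the degree in the $X_i$), then $f^h=\sum_{j=0}^{D}X_0^{D-j}f_j$. For $f\in\Lambda$, $f^{(n)}=f(X_1,\ldots,X_n,0,0,\ldots)\in\mathbb{R}[X_1,\ldots,X_n]$ denotes its truncation to $n$ variables. $\mathbb{R}^\infty$ is the set of real sequences with only finitely many non-zero entries. A symmetric function $g$ is an any-dimensional sum of squares if, for every $n\in\mathbb{N}$, $g^{(n)}$ is a sum of squares of polynomials in $\mathbb{R}[X_1,\ldots,X_n]$. *)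

(* Defs.v *)
From HB Require Import structures.
From mathcomp Require Import all_boot all_order all_algebra.
From mathcomp Require Import finmap reals.
From mathcomp Require Import -(notations) mpoly.
From mathcomp Require Import monalg.

Set Implicit Arguments.
Unset Strict Implicit.
Unset Printing Implicit Defensive.

Import GRing.Theory.
Local Open Scope ring_scope.

(* Lambda = R[p_1, p_2, ...], the polynomial ring over the countable family of
   power sums, which are algebraically independent.  The indeterminates are
   indexed from 0: the one with index i is p_{i+1}, of degree i+1 in the X's.
   Likewise, the variables X_1, X_2, ... are indexed from 0. *)
Notation symfun R := (malg (cmonom nat) R).

(* p_k, to be used for k >= 1 only. *)
Definition powersum (R : realType) (k : nat) : symfun R :=
  << (ucm k.-1 : {cmonom nat}) >>.

(* R[p_2, p_3, ...], as a subset of Lambda. *)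
Definition p1_free (R : realType) (f : symfun R) : Prop :=
  forall m : {cmonom nat}, m \in msupp f -> m 0%N = 0%N.

Section MonomialValue.
Variables (S : comNzRingType) (v : nat -> S).

Definition mon_value (m : {cmonom nat}) : S :=
  \prod_(i <- finsupp m) v i ^+ m i.

Lemma mon_valueEw (m : {cmonom nat}) (d : {fset nat}) :
  (finsupp m `<=` d)%fset -> mon_value m = \prod_(i <- d) v i ^+ m i.
Proof.
move=> le_md; rewrite /mon_value (big_fset_incl _ le_md) // => i _ iNm.
by move: iNm; rewrite -cmE_eq0 => /eqP ->; rewrite expr0.
Qed.

Lemma mon_value_is_multiplicative : mmorphism mon_value.
Proof.
split=> [m1 m2|]; last by rewrite /mon_value mdom1 big_seq_fset0.
rewrite {1}/mon_value mdomD (mon_valueEw (fsubsetUl _ (finsupp m2))).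
rewrite (mon_valueEw (fsubsetUr (finsupp m1) _)) -big_split /=.
by apply: eq_bigr => i _; rewrite cmM exprD.
Qed.

HB.instance Definition _ :=
  isMultiplicative.Build {cmonom nat} S mon_value mon_value_is_multiplicative.

Lemma mon_valueU (i : nat) : mon_value (ucm i) = v i.
Proof. by rewrite /mon_value mdomU big_seq_fset1 cmUU expr1. Qed.

End MonomialValue.

(* The truncation f^(n) in R[X_1, ..., X_n]. *)
Definition truncation (R : realType) (n : nat) :
    symfun R -> mpoly n R :=
  mmap (@mpolyC n R)
       (mon_value (fun i : nat =>
          \sum_(j < n) mpolyX R (mnm1 j) ^+ i.+1)).

(* R^infinity, the finitely supported real sequences *)
Notation finseq R := {fsfun nat -> R with 0%R}.

(* The value f(x) of a symmetric function at a point x of R^infinity. *)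
Definition symeval (R : realType) (x : finseq R) : symfun R -> R :=
  mmap idfun
       (mon_value (fun i : nat => \sum_(j <- finsupp x) x j ^+ i.+1)).

HB.instance Definition _ (R : realType) (n : nat) :=
  GRing.RMorphism.on (@truncation R n).
HB.instance Definition _ (R : realType) (x : finseq R) :=
  GRing.RMorphism.on (@symeval R x).

Lemma truncation_powersum (R : realType) (n k : nat) : (0 < k)%N ->
  truncation n (powersum R k) =
  \sum_(j < n) mpolyX R (mnm1 j) ^+ k.
Proof.
by case: k => // k _; rewrite /truncation mmapU mon_valueU /= mpolyC1 mul1r.
Qed.

Lemma symeval_powersum (R : realType) (x : finseq R) (k : nat) : (0 < k)%N ->
  symeval x (powersum R k) = \sum_(j <- finsupp x) x j ^+ k.
Proof. by case: k => // k _; rewrite /symeval mmapU mon_valueU mul1r. Qed.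

(* Degrees and homogeneous components refer to the X's, not to the p_k. *)
Definition Xdeg (m : {cmonom nat}) : nat :=
  (\sum_(i <- finsupp m) m i * i.+1)%N.

Definition symdeg (R : realType) (f : symfun R) : nat :=
  (\max_(m <- msupp f) Xdeg m)%N.

Definition homcomp (R : realType) (f : symfun R) (j : nat) : symfun R :=
  \sum_(m <- msupp f | Xdeg m == j) << f@_m *g m >>.

Lemma homcomp_sum (R : realType) (f : symfun R) :
  \sum_(j < (symdeg f).+1) homcomp f j = f.
Proof.
rewrite [RHS]monalgE /homcomp (exchange_big_dep xpredT) //=.
apply: eq_big_seq => m mf.
have lt : (Xdeg m < (symdeg f).+1)%N.
  by rewrite ltnS /symdeg (big_rem m) //= leq_maxl.
by rewrite (big_pred1 (Ordinal lt)) // => j; rewrite -val_eqE /= eq_sym.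
Qed.

Lemma homcomp_homog (R : realType) (n : nat) (f : symfun R) (j : nat) :
  truncation n (homcomp f j) \is ishomog1 j mpoly.mdeg.
Proof.
rewrite raddf_sum; apply: rpred_sum => m /eqP <- /=.
rewrite /truncation monalg.mmapU /= mul_mpolyC; apply: rpredZ.
rewrite /mon_value /Xdeg; elim: (enum_fset _) => [|i s IHs].
  by rewrite !big_nil dhomog1.
rewrite !big_cons; apply: dhomogM IHs; rewrite mulnC; apply: dhomogMn.
apply: rpred_sum => k _.
have hX : mpolyX R (mnm1 k) \is ishomog1 1 mpoly.mdeg.
  by rewrite dhomogX; apply/eqP; exact: mpoly.mdeg1.
by have := dhomogMn i.+1 hX; rewrite mul1n; exact.
Qed.

(* f^h, as a polynomial in X_0 with coefficients in Lambda. *)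
Definition homogenization (R : realType) (f : symfun R) : {poly symfun R} :=
  \sum_(j < (symdeg f).+1) 'X^(symdeg f - j) * (homcomp f j)%:P.

(* g(x_0, x) for g in Lambda[X_0]. *)
Definition eval_homog (R : realType) (g : {poly symfun R}) (x0 : R)
    (x : finseq R) : R :=
  (map_poly (symeval x) g).[x0].

Lemma eval_homogE (R : realType) (f : symfun R) (x0 : R) (x : finseq R) :
  eval_homog (homogenization f) x0 x =
  \sum_(j < (symdeg f).+1) x0 ^+ (symdeg f - j) * symeval x (homcomp f j).
Proof.
rewrite /eval_homog /homogenization rmorph_sum horner_sum; apply: eq_bigr => j _.
by rewrite rmorphM /= map_polyXn map_polyC hornerM hornerXn hornerC.
Qed.

Definition is_sos (A : pzSemiRingType) (a : A) : Prop :=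
  exists s : seq A, a = \sum_(q <- s) q ^+ 2.

Definition anydim_sos (R : realType) (g : symfun R) : Prop :=
  forall n : nat, (0 < n)%N -> is_sos (truncation n g).

(* Main.v *)
Require Import Defs.
From HB Require Import structures.
From mathcomp Require Import all_boot all_order all_algebra.
From mathcomp Require Import finmap reals boolp.
From mathcomp Require Import -(notations) mpoly.
From mathcomp Require Import monalg.
From mathcomp Require Import ring lra zify.

(** Work on the sphere s^2 = x_0^2 + sum_i x_i^2, where s is a formal square
    root of 1 + p_2 and x_0 = 1.  The proof is a version of Polya's argument in
    which no constant depends on the number of variables.

    Polya's argument.  Let t range over the probability vectors on a finite set
    of letters, and let G(t) be the expectation of g(w_1, ..., w_d) for letters
    drawn independently with law t.  If G >= eps on the whole simplex, then
    (sum t)^(M - d) G(t) is, up to a factor, the sum over all words v of length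
    M of the monomial of v times the average of g over d draws from v without
    replacement.  This average differs from G(frequencies of v) >= eps by at
    most a multiple of d^2 sup|g| / M, so that all coefficients are nonnegative
    as soon as M is large compared with sup|g|, d and 1/eps, however many
    letters there are ([polya]).  Substituting sums of squares for the letters
    then yields a sum of squares.

    Letters.  For even power sums the letters x_i^2 would do.  Odd power sums
    need the signs of the x_i: each x_i^2 / s^2 is split by the Bernstein
    polynomials in x_i / s on [-1, 1], which are sums of squares on the sphere
    because 2 s (s + z) = (s + z)^2 + (s^2 - z^2).  A letter thus names a
    coordinate together with an approximate value y of x_i / s.  In the ring,
    the mass m_i of the block of i becomes x_i^2, and its first moment a_i (the
    drift) becomes x_i^3; hence p_(2a) = sum_i m_i^a and
    p_(2a+3) = sum_i m_i^a a_i.  This is where the absence of p_1 is used: it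
    has no such expression.  One more binary mark gives access to x_0, which
    may occur with odd exponents in the homogenization.

    Positivity on the simplex.  A point of the simplex need not come from the
    sphere, so multiples of three penalties, which vanish identically in the
    ring, are added to f.  Put x_i = +-sqrt(m_i) with the sign of a_i.  The
    total error sum_i |a_i - x_i m_i| in the odd power sums is bounded by a
    small number plus multiples of the penalties, independently of n
    ([sum_rounded_gap]).  As f is Lipschitz in the power sums, f plus penalties
    is at least eps / 2 on the simplex ([penalized_ge]), and Polya's argument
    shows that s^e f is a sum of squares, for some e depending on f and eps
    only ([homog_value_sos]).  Since f has even degree, e = 2k, and taking
    components free of s turns this into an identity for (1 + p_2)^k f. *)

Set Implicit Arguments.
Unset Strict Implicit.
Unset Printing Implicit Defensive.

Import Order.TTheory GRing.Theory Num.Theory.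
Local Open Scope ring_scope.

(** * Sums of squares *)

Section SumsOfSquares.
Variable A : comNzRingType.
Implicit Types a b : A.

Lemma sos0 : is_sos (0 : A).
Proof. by exists [::]; rewrite big_nil. Qed.

Lemma sos_sqr a : is_sos (a ^+ 2).
Proof. by exists [:: a]; rewrite big_seq1. Qed.

Lemma sosD a b : is_sos a -> is_sos b -> is_sos (a + b).
Proof. by move=> [s ->] [r ->]; exists (s ++ r); rewrite big_cat. Qed.

Lemma sos_sum (I : Type) (r : seq I) (P : pred I) (F : I -> A) :
  (forall i, P i -> is_sos (F i)) -> is_sos (\sum_(i <- r | P i) F i).
Proof. by move=> sF; elim/big_ind: _ => //; [exact: sos0|exact: sosD]. Qed.

Lemma sosM a b : is_sos a -> is_sos b -> is_sos (a * b).
Proof.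
move=> [s ->] [r ->]; rewrite mulr_suml; apply: sos_sum => p _.
rewrite mulr_sumr; apply: sos_sum => q _; rewrite -exprMn; exact: sos_sqr.
Qed.

Lemma sos1 : is_sos (1 : A).
Proof. rewrite -(expr1n A 2); exact: sos_sqr. Qed.

Lemma sosX a n : is_sos a -> is_sos (a ^+ n).
Proof.
move=> sa; elim: n => [|n IHn]; first exact: sos1.
rewrite exprS; exact: sosM.
Qed.

Lemma sos_morph (R : rcfType) (iota : {rmorphism R -> A}) (c : R) :
  0 <= c -> is_sos (iota c).
Proof. move=> c0; rewrite -(sqr_sqrtr c0) rmorphXn; exact: sos_sqr. Qed.

Lemma sos_nat (R : rcfType) (iota : {rmorphism R -> A}) m : is_sos (iota m%:R).
Proof. by apply: sos_morph; rewrite ler0n. Qed.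

End SumsOfSquares.

(** * Contraction of tensors and sampling without replacement *)

Section Contraction.
Variables (R : realFieldType) (W : finType).
Implicit Types (g h : seq W -> R) (u v : seq W).

Section Algebra.
Variables (A : comNzRingType) (iota : {rmorphism R -> A}).
Implicit Types (t : W -> A).

(** The value at t of the homogeneous form of degree d with coefficient tensor
    g, that is, the expectation of g over d independent letters of law t.
    Tensors are functions of words, which makes their product a mere
    concatenation of arguments. *)
Fixpoint contract d g t : A :=
  if d is d'.+1 then \sum_w t w * contract d' (fun u => g (w :: u)) t
  else iota (g [::]).

Lemma eq_contract d g h t :
  (forall u, size u = d -> g u = h u) -> contract d g t = contract d h t.
Proof.
elim: d g h => [|d IHd] g h gh /=; first by rewrite gh.
by apply: eq_bigr => w _; congr (_ * _); apply: IHd => u su; rewrite gh /= ?su.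
Qed.

Lemma contractD d g h t :
  contract d (fun u => g u + h u) t = contract d g t + contract d h t.
Proof.
elim: d g h => [|d IHd] g h /=; first by rewrite rmorphD.
by rewrite -big_split; apply: eq_bigr => w _; rewrite IHd mulrDr.
Qed.

Lemma contractZ d c g t :
  contract d (fun u => c * g u) t = iota c * contract d g t.
Proof.
elim: d g => [|d IHd] g /=; first by rewrite rmorphM.
by rewrite mulr_sumr; apply: eq_bigr => w _; rewrite IHd mulrCA.
Qed.

Lemma contract0 d t : contract d (fun=> 0) t = 0.
Proof.
elim: d => [|d IHd] /=; first by rewrite rmorph0.
by rewrite big1 // => w _; rewrite IHd mulr0.
Qed.

Lemma contract_sum (I : Type) (r : seq I) d (g : I -> seq W -> R) t :
  contract d (fun u => \sum_(i <- r) g i u) t = \sum_(i <- r) contract d (g i) t.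
Proof.
elim: r => [|i r IHr].
  by rewrite big_nil -(contract0 d t); apply: eq_contract => u _; rewrite big_nil.
rewrite big_cons -IHr -contractD.
by apply: eq_contract => u _; rewrite big_cons.
Qed.

Lemma contract_cst d c t :
  contract d (fun=> c) t = iota c * (\sum_w t w) ^+ d.
Proof.
elim: d => [|d IHd] /=; first by rewrite mulr1.
by rewrite -mulr_suml IHd exprS mulrCA.
Qed.

Lemma contractM d1 d2 g h t :
  contract (d1 + d2) (fun u => g (take d1 u) * h (drop d1 u)) t =
  contract d1 g t * contract d2 h t.
Proof.
elim: d1 g => [|d1 IHd] g.
  by rewrite -contractZ; apply: eq_contract => u _; rewrite take0 drop0.
rewrite addSn /= mulr_suml; apply: eq_bigr => w _.
by rewrite -mulrA -(IHd (fun u => g (w :: u))).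
Qed.

Lemma contract_scale d g c t :
  contract d g (fun w => c * t w) = c ^+ d * contract d g t.
Proof.
elim: d g => [|d IHd] g /=; first by rewrite expr0 mul1r.
by rewrite mulr_sumr; apply: eq_bigr => w _; rewrite IHd exprS; ring.
Qed.

End Algebra.

Fixpoint draws v : seq (W * seq W) :=
  if v is w :: v' then (w, v') :: [seq (p.1, w :: p.2) | p <- draws v']
  else [::].

(** Sampling without replacement. Draws are told apart by position, so that a
    word of length M has M^_d of them even if letters repeat. *)
Fixpoint sample d g v : R :=
  if d is d'.+1 then \sum_(p <- draws v) sample d' (fun u => g (p.1 :: u)) p.2
  else g [::].

Lemma size_draws v : size (draws v) = size v.
Proof. by elim: v => //= w v IHv; rewrite size_map IHv. Qed.

Lemma perm_draws v p : p \in draws v -> perm_eq (p.1 :: p.2) v.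
Proof.
elim: v p => //= w v IHv p; rewrite inE => /orP[/eqP-> //|/mapP[r rv -> /=]].
rewrite (perm_catCA [:: r.1] [:: w] r.2) /= perm_cons; exact: IHv.
Qed.

Lemma sum_draws v (k : W -> R) :
  \sum_(p <- draws v) k p.1 = \sum_w (count_mem w v)%:R * k w.
Proof.
have -> : \sum_(p <- draws v) k p.1 = \sum_(w <- v) k w.
  by elim: v => [|w v IHv] /=; rewrite ?big_nil // !big_cons big_map IHv.
elim: v => [|w v IHv]; first by rewrite big_nil big1 // => w _; rewrite mul0r.
rewrite big_cons IHv /= [RHS](eq_bigr
  (fun w' => (w == w')%:R * k w' + (count_mem w' v)%:R * k w')); last first.
  by move=> w' _; rewrite natrD mulrDl.
rewrite big_split /=; congr (_ + _).
rewrite (bigD1 w) //= eqxx mul1r big1 ?addr0 // => w' /negPf.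
by rewrite eq_sym => ->; rewrite mul0r.
Qed.

(** Summed over all words, every position plays the same role. *)
Lemma contract_draws (A : comNzRingType) (iota : {rmorphism R -> A}) M
    (h : W -> seq W -> R) t :
  contract iota M.+1 (fun v => \sum_(p <- draws v) h p.1 p.2) t =
  M.+1%:R * \sum_w t w * contract iota M (h w) t.
Proof.
elim: M h => [|M IHM] h.
  rewrite mul1r /=; apply: eq_bigr => w _.
  by rewrite big_seq1.
rewrite [LHS]/=.
under eq_bigr => w _.
  rewrite (_ : \sum_w0 _ = contract iota M.+1 (fun v => h w v +
     \sum_(p <- draws v) h p.1 (w :: p.2)) t); last first.
    by rewrite /=; apply: eq_bigr => w' _; congr (_ * _); apply: eq_contract => u _;
      rewrite !big_cons !big_map.
  rewrite contractD (IHM (fun x u => h x (w :: u))) mulrDr.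
over.
rewrite big_split /= -[M.+2]addn1 natrD mulrDl mul1r addrC; congr (_ + _).
transitivity (M.+1%:R * \sum_w \sum_w' t w * (t w' *
   contract iota M (fun u => h w' (w :: u)) t)).
  rewrite mulr_sumr; apply: eq_bigr => w _; rewrite mulrCA; congr (_ * _).
  by rewrite mulr_sumr.
congr (_ * _); rewrite exchange_big; apply: eq_bigr => w' _.
by rewrite mulr_sumr; apply: eq_bigr => w _; rewrite mulrCA.
Qed.

(** The generating function of sampling without replacement: the d drawn
    letters are independent, and the M - d others are free. *)
Lemma contract_sample (A : comNzRingType) (iota : {rmorphism R -> A}) M d g t :
  (d <= M)%N ->
  contract iota M (sample d g) t =
  (M ^_ d)%:R * (\sum_w t w) ^+ (M - d) * contract iota d g t.
Proof.
elim: d M g => [|d IHd] M g.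
  by move=> _; rewrite ffactn0 mul1r subn0 /= contract_cst mulrC.
case: M => // M; rewrite ltnS => dM.
rewrite (contract_draws iota M (fun w v => sample d (fun u => g (w :: u)) v)).
rewrite /= ffactSS natrM subSS -!mulrA; congr (_ * _).
rewrite !mulr_sumr; apply: eq_bigr => w _.
by rewrite IHd //; ring.
Qed.

Lemma contract_ge0 d g (t : W -> R) :
  (forall u, 0 <= g u) -> (forall w, 0 <= t w) -> 0 <= contract idfun d g t.
Proof.
move=> + t0; elim: d g => [|d IHd] g g0 /=; first exact: g0.
by apply: sumr_ge0 => w _; rewrite mulr_ge0 // IHd.
Qed.

Lemma le_contract d g (t t' : W -> R) :
  (forall u, 0 <= g u) -> (forall w, 0 <= t w <= t' w) ->
  contract idfun d g t <= contract idfun d g t'.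
Proof.
move=> + tt'; elim: d g => [|d IHd] g g0 //=.
apply: ler_sum => w _; have /andP[t0 tle] := tt' w.
by apply: ler_pM => //; rewrite ?IHd //; apply: contract_ge0 => // x; case/andP: (tt' x).
Qed.

(** Draws without replacement are among those with replacement, for which the
    sum is the contraction of g with the letter counts. *)
Lemma sample_le d g v : (forall u, 0 <= g u) ->
  sample d g v <= contract idfun d g (fun w => (count_mem w v)%:R).
Proof.
elim: d g v => [|d IHd] g v g0 //=.
rewrite -(sum_draws v (fun w => contract idfun d (fun u => g (w :: u))
   (fun w => (count_mem w v)%:R))).
rewrite big_seq [leRHS]big_seq; apply: ler_sum => p pv.
apply: le_trans (IHd _ _ _) _ => //.
apply: le_contract => // w; rewrite ler0n ler_nat.
by have /permP/(_ (pred1 w)) <- := perm_draws pv; rewrite leq_addl.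
Qed.

Lemma sampleBl d c g v :
  sample d (fun u => c - g u) v = c * (size v ^_ d)%:R - sample d g v.
Proof.
elim: d g v => [|d IHd] g v /=; first by rewrite mulr1.
rewrite (eq_big_seq (fun p => c * ((size v).-1 ^_ d)%:R -
   sample d (fun u => g (p.1 :: u)) p.2)); last first.
  move=> p pv; rewrite IHd; congr (_ * _%:R - _).
  by have /perm_size <- := perm_draws pv.
rewrite sumrB; congr (_ - _).
rewrite big_const_seq count_predT size_draws iter_addr_0 -[LHS]mulr_natr -mulrA -natrM.
by case: (size v) => [|k]; rewrite ?muln0 ?ffact0n ?ffactSS 1?mulnC.
Qed.

Definition simplex (t : W -> R) := (forall w, 0 <= t w) /\ \sum_w t w = 1.

Lemma sum_count v : \sum_w (count_mem w v)%:R = (size v)%:R :> R.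
Proof.
rewrite -size_draws -sum1_size natr_sum (sum_draws v (fun=> 1)).
by apply: eq_bigr => w _; rewrite mulr1.
Qed.

Lemma simplex_freq v : (0 < size v)%N ->
  simplex (fun w => (size v)%:R^-1 * (count_mem w v)%:R).
Proof.
move=> v0; split=> [w|]; first by rewrite mulr_ge0 ?invr_ge0 ?ler0n.
by rewrite -mulr_sumr sum_count mulVf // pnatr_eq0 -lt0n.
Qed.

(** At most d^2 M^(d-1) of the M^d maps from d points to M points fail to be
    injective; multiplied by M, to avoid a predecessor. *)
Lemma leq_exp_ffact M d : (M ^ d.+1 <= M * M ^_ d + d ^ 2 * M ^ d)%N.
Proof.
elim: d => [|d IHd]; first by rewrite expn1 ffactn0 muln1 leq_addr.
rewrite ffactnSr; have [Md|dM] := leqP M d.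
  have -> : (M - d = 0)%N by apply/eqP.
  rewrite muln0 muln0 add0n expnS leq_mul2r.
  by rewrite (leq_trans (leq_trans Md (leqnSn d))) ?orbT // -{1}(expn1 d.+1) leq_pexp2l.
have MM : (M * M ^ d.+1 <= M * (M * M ^_ d + d ^ 2 * M ^ d))%N.
  by rewrite leq_mul2l IHd orbT.
rewrite expnS; apply: leq_trans MM _.
have E : (M * (M ^_ d * (M - d)) + M * M ^_ d * d = M * (M * M ^_ d))%N.
  by rewrite -[(_ * d)%N]mulnA -!mulnDr subnK 1?ltnW // [(_ * M)%N]mulnC.
have L : (M ^_ d <= M ^ d)%N.
  elim: (d) => // k; rewrite ffactnSr expnSr => H; exact: leq_mul (H) (leq_subr _ _).
have L2 : (M * M ^_ d * d <= M ^ d.+1 * d)%N by rewrite expnS leq_mul2r leq_mul2l L !orbT.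
rewrite mulnDr -E -addnA leq_add2l.
apply: leq_trans (leq_add L2 (leqnn _)) _.
rewrite [(M * (d ^ 2 * _))%N]mulnCA -expnS.
by rewrite mulnC -mulnDl leq_mul2r; apply/orP; right;
  rewrite -[d.+1]addn1 sqrnD muln1 mul2n -addnn [leqLHS]addnC -addnA
          leq_add2l addnA leq_addl.
Qed.

(** Comparing the draws of C - g >= 0 with and without replacement shows that
    the average of g without replacement drops below eps by at most C d^2 / M. *)
Lemma sample_ge0 d g C eps v :
  (forall u, g u <= C) ->
  (forall t, simplex t -> eps <= contract idfun d g t) ->
  0 <= C -> (0 < size v)%N -> C * (d ^ 2)%:R <= eps * (size v)%:R ->
  0 <= sample d g v.
Proof.
move=> gC geps C0 v0 Mlarge; set M := size v in v0 Mlarge *.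
have M0 : 0 < M%:R :> R by rewrite ltr0n.
have := @sample_le d (fun u => C - g u) v.
rewrite sampleBl -/M => /(_ _)/wrap[u|]; first by rewrite subr_ge0.
set cnt := (fun w => (count_mem w v)%:R) => le1.
have E : contract idfun d (fun u => C - g u) cnt =
    M%:R ^+ d * (C - contract idfun d g (fun w => M%:R^-1 * cnt w)).
  rewrite (eq_contract idfun (h := fun u => C + -1 * g u)); last first.
    by move=> u; rewrite mulN1r.
  rewrite contractD contractZ contract_cst.
  rewrite contract_scale /=.
  rewrite sum_count -/M /=.
  by rewrite [RHS]mulrBr [M%:R ^+ d * (_ * _)]mulrA -exprMn mulfV ?gt_eqF // expr1n; ring.
have := geps _ (simplex_freq v0); rewrite -/M => le2.
have le3 : (M ^ d.+1)%:R <= (M * M ^_ d + d ^ 2 * M ^ d)%:R :> R.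
  by rewrite ler_nat leq_exp_ffact.
move: le3 le1; rewrite E natrD !natrM natrX exprS => le3 le1.
set S := sample d g v in le1 *.
set c := contract _ _ _ _ in le1 le2; set x := (M ^_ d)%:R in le1 le3.
have p0 : 0 < M%:R ^+ d :> R by rewrite exprn_gt0.
rewrite natrX in le3.
set p := M%:R ^+ d in le1 le3 p0.
rewrite -(pmulr_rge0 _ M0).
have h1 : p * eps <= p * c by rewrite ler_pM2l.
have h2 : M%:R * (C * x - S) <= M%:R * (p * (C - c)) by rewrite ler_pM2l.
have h3 : M%:R * (p * eps) <= M%:R * (p * c) by rewrite ler_pM2l.
have h4 : C * (M%:R * p) <= C * (M%:R * x + (d ^ 2)%:R * p) by rewrite ler_wpM2l // natrX.
have h5 : p * (C * (d ^ 2)%:R) <= p * (eps * M%:R) by rewrite ler_pM2l.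
nra.
Qed.

End Contraction.

Lemma sos_contract (R : rcfType) (W : finType) (A : comNzRingType)
    (iota : {rmorphism R -> A}) d (g : seq W -> R) (t : W -> A) :
  (forall u, size u = d -> 0 <= g u) -> (forall w, is_sos (t w)) ->
  is_sos (contract iota d g t).
Proof.
move=> + st; elim: d g => [|d IHd] g g0 /=; first exact/sos_morph/g0.
by apply: sos_sum => w _; apply: sosM => //; apply: IHd => u su; rewrite g0 //= su.
Qed.

(** Polya's theorem for bounded tensors. The lower bound on M does not involve
    the number of letters. *)
Lemma polya (R : rcfType) (W : finType) (A : comNzRingType)
    (iota : {rmorphism R -> A}) d (g : seq W -> R) (t : W -> A) C eps M :
  (forall u, g u <= C) -> 0 <= C ->
  (forall r, simplex r -> eps <= contract idfun d g r) ->
  (0 < M)%N -> (d <= M)%N -> C * (d ^ 2)%:R <= eps * M%:R ->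
  (forall w, is_sos (t w)) ->
  is_sos ((\sum_w t w) ^+ (M - d) * contract iota d g t).
Proof.
move=> gC C0 geps M0 dM Mlarge st.
have -> : (\sum_w t w) ^+ (M - d) * contract iota d g t =
    iota (M ^_ d)%:R^-1 * contract iota M (sample d g) t.
  rewrite contract_sample // -(rmorph_nat iota) !mulrA -rmorphM mulVf ?rmorph1 ?mul1r //.
  by rewrite pnatr_eq0 -lt0n ffact_gt0.
apply: sosM; first by apply: sos_morph; rewrite invr_ge0 ler0n.
apply: sos_contract => // v sv.
by apply: (sample_ge0 gC geps) => //; rewrite sv.
Qed.

(** * Bounded tensors computing a given element of the ring *)

Section Representation.
Variables (R : realFieldType) (W : finType) (B : comNzRingType).
Variables (iota : {rmorphism R -> B}) (tau : W -> B) (s : B) (N : nat).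
Hypothesis sum_tau : \sum_w tau w = s ^+ N.+1.
Implicit Types (hd : pred W) (Phi : (W -> R) -> R) (beta : B).

(** A tensor of degree d bounded by C whose form is Phi on the simplex and is
    beta, up to the power of s that makes degrees match, in the ring. The
    support condition on the first letter keeps C from growing when tensors
    attached to disjoint blocks of letters are added up. *)
Definition represents hd d C Phi beta := exists g : seq W -> R,
  [/\ forall u, `|g u| <= C,
      forall w u, ~~ hd w -> g (w :: u) = 0,
      forall t, simplex t -> contract idfun d g t = Phi t &
      contract iota d g tau = s ^+ (N * d) * beta].

Lemma represents_pos hd d C Phi beta : represents hd d C Phi beta -> 0 <= C.
Proof. by case=> g [gC _ _ _]; apply: le_trans (gC [::]). Qed.

Lemma represents_conv hd d d' C C' Phi Phi' beta beta' :
  represents hd d C Phi beta -> d = d' -> C <= C' ->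
  (forall t, simplex t -> Phi t = Phi' t) -> beta = beta' ->
  represents hd d' C' Phi' beta'.
Proof.
move=> [g [gC ghd gt gtau]] <- CC' PhiE <-; exists g; split=> // [u|t st].
  exact: le_trans (gC u) CC'.
by rewrite -PhiE // gt.
Qed.

Lemma represents_predT hd d C Phi beta :
  represents hd d C Phi beta -> represents predT d C Phi beta.
Proof. by case=> g [? _ ? ?]; exists g. Qed.

(** Used for padding: the sum of all letters is 1 on the simplex. *)
Lemma represents1 d : represents predT d 1 (fun=> 1) (s ^+ d).
Proof.
exists (fun=> 1); split=> // [u|t [_ t1]|]; first by rewrite normr1.
  by rewrite contract_cst t1 expr1n mulr1.
by rewrite contract_cst sum_tau rmorph1 mul1r -exprM mulSn exprD mulrC.
Qed.

Lemma represents0 hd d : represents hd d 0 (fun=> 0) 0.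
Proof.
exists (fun=> 0); split=> // [u|t _|]; first by rewrite normr0.
  by rewrite contract0.
by rewrite contract0 mulr0.
Qed.

Lemma representsD hd d C1 C2 Phi1 Phi2 beta1 beta2 :
  represents hd d C1 Phi1 beta1 -> represents hd d C2 Phi2 beta2 ->
  represents hd d (C1 + C2) (fun t => Phi1 t + Phi2 t) (beta1 + beta2).
Proof.
move=> [g1 [C1g h1 t1 b1]] [g2 [C2g h2 t2 b2]].
exists (fun u => g1 u + g2 u); split=> [u|w u hw|t st|].
- exact: le_trans (ler_normD _ _) (lerD (C1g u) (C2g u)).
- by rewrite h1 // h2 // addr0.
- by rewrite contractD t1 // t2.
by rewrite contractD b1 b2 mulrDr.
Qed.

Lemma representsZ hd d C c Phi beta :
  represents hd d C Phi beta ->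
  represents hd d (`|c| * C) (fun t => c * Phi t) (iota c * beta).
Proof.
move=> [g [Cg h t b]]; exists (fun u => c * g u); split=> [u|w u hw|r sr|].
- by rewrite normrM ler_wpM2l.
- by rewrite h // mulr0.
- by rewrite contractZ t.
by rewrite contractZ b mulrCA.
Qed.

Lemma represents_sum (I : eqType) (r : seq I) hd d (C : I -> R)
    (Phi : I -> (W -> R) -> R) (beta : I -> B) :
  (forall i, i \in r -> represents hd d (C i) (Phi i) (beta i)) ->
  represents hd d (\sum_(i <- r) C i) (fun t => \sum_(i <- r) Phi i t)
    (\sum_(i <- r) beta i).
Proof.
elim: r => [|i r IHr] rep.
  rewrite !big_nil; apply: represents_conv (represents0 hd d) _ _ _ _ => //.
  by move=> t _; rewrite big_nil.
have {}IHr := IHr (fun j jr => rep j (mem_behead (s := i :: r) jr)).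
rewrite !big_cons.
apply: represents_conv (representsD (rep i (mem_head i r)) IHr) _ _ _ _ => //.
by move=> t _; rewrite big_cons.
Qed.

Lemma representsM_aux hd d1 d2 C1 C2 Phi1 Phi2 beta1 beta2 :
  (0 < d1)%N \/ hd =1 predT ->
  represents hd d1 C1 Phi1 beta1 -> represents predT d2 C2 Phi2 beta2 ->
  represents hd (d1 + d2) (C1 * C2) (fun t => Phi1 t * Phi2 t) (beta1 * beta2).
Proof.
move=> d1P [g1 [C1g h1 t1 b1]] [g2 [C2g _ t2 b2]].
exists (fun u => g1 (take d1 u) * g2 (drop d1 u)); split=> [u|w u hw|t st|].
- by rewrite normrM ler_pM.
- case: d1P => [d1_gt0|hT]; last by rewrite hT in hw.
  by rewrite -(prednK d1_gt0) /= h1 // mul0r.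
- by rewrite contractM t1 // t2.
by rewrite contractM b1 b2 mulnDr exprD; ring.
Qed.

Lemma representsM d1 d2 C1 C2 Phi1 Phi2 beta1 beta2 :
  represents predT d1 C1 Phi1 beta1 -> represents predT d2 C2 Phi2 beta2 ->
  represents predT (d1 + d2) (C1 * C2) (fun t => Phi1 t * Phi2 t)
    (beta1 * beta2).
Proof. by apply: representsM_aux; right. Qed.

Lemma representsM_head hd d1 d2 C1 C2 Phi1 Phi2 beta1 beta2 :
  represents hd d1.+1 C1 Phi1 beta1 -> represents predT d2 C2 Phi2 beta2 ->
  represents hd (d1.+1 + d2) (C1 * C2) (fun t => Phi1 t * Phi2 t)
    (beta1 * beta2).
Proof. by apply: representsM_aux; left. Qed.

Lemma representsX d C Phi beta k :
  represents predT d C Phi beta ->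
  represents predT (d * k) (C ^+ k) (fun t => Phi t ^+ k) (beta ^+ k).
Proof.
move=> rep; elim: k => [|k IHk]; first by rewrite muln0; exact: (represents1 0).
have [g gP] := representsM rep IHk; exists g.
by rewrite mulnS !exprS; case: gP => ? ? gt ?; split=> // t st; rewrite gt // exprS.
Qed.

Lemma represents_prod (I : eqType) (r : seq I) (d : I -> nat)
    (Phi : I -> (W -> R) -> R) (beta : I -> B) :
  (forall i, i \in r -> represents predT (d i) 1 (Phi i) (beta i)) ->
  represents predT (\sum_(i <- r) d i) 1 (fun t => \prod_(i <- r) Phi i t)
    (\prod_(i <- r) beta i).
Proof.
elim: r => [|i r IHr] rep.
  rewrite !big_nil; apply: represents_conv (represents1 0) _ _ _ _ => //.
  by move=> t _; rewrite big_nil.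
have {}IHr := IHr (fun j jr => rep j (mem_behead (s := i :: r) jr)).
rewrite !big_cons.
apply: represents_conv (representsM (rep i (mem_head i r)) IHr) _ _ _ _ => //.
  by rewrite mulr1.
by move=> t _; rewrite big_cons.
Qed.

Lemma represents_linear hd d C (phi : W -> R) beta :
  0 <= C -> (forall w, `|phi w| <= C) -> (forall w, ~~ hd w -> phi w = 0) ->
  s ^+ d * (\sum_w iota (phi w) * tau w) = s ^+ N * beta ->
  represents hd d.+1 C (fun t => \sum_w phi w * t w) beta.
Proof.
move=> C0 phiC phihd phitau.
exists (fun u => if u is w :: _ then phi w else 0).
split=> [[|w u]|w u|t [_ t1]|] //; first by rewrite normr0.
- by move/phihd.
- rewrite /=; apply: eq_bigr => w _.
  by rewrite contract_cst t1 expr1n mulr1 mulrC.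
rewrite /=; under eq_bigr => w _ do rewrite contract_cst sum_tau mulrCA mulrA.
by rewrite -mulr_suml -exprM mulSn exprD mulrA [_ * s ^+ d]mulrC phitau mulnS exprD; ring.
Qed.

(** The first letter determines the only block that contributes, so the bound
    does not depend on the number of blocks. *)
Lemma represents_blocks (I : finType) (block_of : W -> option I) d C
    (Phi : I -> (W -> R) -> R) (beta : I -> B) :
  (forall i, represents [pred w | block_of w == Some i] d.+1 C (Phi i) (beta i)) ->
  0 <= C ->
  represents predT d.+1 C (fun t => \sum_i Phi i t) (\sum_i beta i).
Proof.
move=> /choice[g gP] C0.
exists (fun u => if u is [::] then 0 else \sum_i g i u); split=> //.
- case=> [|w u]; first by rewrite normr0.
  have g0 i : block_of w != Some i -> g i (w :: u) = 0.
    by move=> wi; have [_ gh _ _] := gP i; apply: gh.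
  case E: (block_of w) => [i|]; last by rewrite big1 ?normr0 // => i _; rewrite g0 // E.
  rewrite (bigD1 i) //= big1 ?addr0; first by have [gC _ _ _] := gP i.
  by move=> j ji; rewrite g0 // E (inj_eq Some_inj) eq_sym.
- move=> t st; rewrite (eq_contract _ (h := fun u => \sum_i g i u)).
    by rewrite contract_sum; apply: eq_bigr => i _; have [_ _ gt _] := gP i; rewrite gt.
  by case.
rewrite (eq_contract _ (h := fun u => \sum_i g i u)); last by case.
rewrite contract_sum mulr_sumr; apply: eq_bigr => i _.
by have [_ _ _ ->] := gP i.
Qed.

End Representation.

(** * Bernstein weights and letters *)

Section Bernstein.
Variable A : comNzRingType.
Implicit Types (a b : A) (h : nat -> A).

Definition bernstein K a b k : A := 'C(K, k)%:R * (a ^+ k * b ^+ (K - k)).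

(** The absorption identity, from which all moments follow. *)
Lemma bernstein_shift K a b h :
  \sum_(k < K.+2) k%:R * h k * bernstein K.+1 a b k =
  K.+1%:R * a * \sum_(k < K.+1) h k.+1 * bernstein K a b k.
Proof.
rewrite big_ord_recl !mul0r add0r mulr_sumr; apply: eq_bigr => k _.
rewrite /bernstein lift0 subSS exprS.
have := mul_bin_diag K.+1 k; move/(congr1 (fun m => m%:R : A)).
rewrite /= !natrM => E.
transitivity (k.+1%:R * 'C(K.+1, k.+1)%:R * (h k.+1 * a * (a ^+ k * b ^+ (K - k)))).
  by ring.
by rewrite -E; ring.
Qed.

Lemma bernstein_sum K a b : \sum_(k < K.+1) bernstein K a b k = (a + b) ^+ K.
Proof.
rewrite addrC exprDn; apply: eq_bigr => k _.
by rewrite /bernstein mulr_natl [b ^+ _ * _]mulrC.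
Qed.

Lemma bernstein_sum1 K a b :
  \sum_(k < K.+2) k%:R * bernstein K.+1 a b k = K.+1%:R * a * (a + b) ^+ K.
Proof.
rewrite -bernstein_sum.
under eq_bigr => k _ do rewrite -[k%:R]mulr1.
rewrite (bernstein_shift K a b (fun=> 1)); congr (_ * _).
by apply: eq_bigr => k _; rewrite mul1r.
Qed.

Lemma bernstein_sum2 K a b :
  \sum_(k < K.+3) k%:R ^+ 2 * bernstein K.+2 a b k =
  K.+2%:R * a * (K.+1%:R * a * (a + b) ^+ K + (a + b) ^+ K.+1).
Proof.
under eq_bigr => k _ do rewrite expr2.
rewrite (bernstein_shift K.+1 a b (fun k => k%:R)); congr (_ * _).
rewrite -bernstein_sum1 -bernstein_sum -big_split; apply: eq_bigr => k _ /=.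
by rewrite -addn1 natrD mulrDl mul1r.
Qed.

End Bernstein.

Section Letters.
Variables (R : rcfType) (B : comNzRingType) (iota : {rmorphism R -> B}).
Variables (n K : nat) (x0 : B) (x : 'I_n -> B) (s : B).
Hypothesis sphere : s ^+ 2 = x0 ^+ 2 + \sum_i x i ^+ 2.

(** A coordinate ([None] for x_0), a Bernstein index and a sign for x_0. The
    degree K + 2 of the Bernstein polynomials is at least 2, so that second
    moments have no degenerate case. *)
Definition letter : finType := (option 'I_n * 'I_K.+3 * bool)%type.

Definition block_of (w : letter) : option 'I_n := w.1.1.

(** The point of [-1, 1] around which the k-th Bernstein weight concentrates. *)
Definition node (k : 'I_K.+3) : R := (2 * k%:R - K.+2%:R) / K.+2%:R.

Definition mark (w : letter) : R := node w.1.2.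

Definition sign (b : bool) : R := if b then 1 else -1.

Definition coord (o : option 'I_n) : B := if o is Some i then x i else x0.

Let half : B := iota 2^-1.

(** The three factors sum up to s^2, s^(2 (K + 2)) and s^2. *)
Definition weight (w : letter) : B :=
  coord w.1.1 ^+ 2 *
  bernstein K.+2 (half * (s * (s + coord w.1.1)))
                 (half * (s * (s - coord w.1.1))) w.1.2 *
  (half * (s * (s + iota (sign w.2) * x0))).

Lemma half2 : half * 2 = 1.
Proof. by rewrite /half -(rmorph_nat iota) -rmorphM mulVf ?rmorph1 ?pnatr_eq0. Qed.

Lemma half_sum z : half * (s * (s + z)) + half * (s * (s - z)) = s ^+ 2.
Proof.
transitivity (half * 2 * s ^+ 2); first by ring.
by rewrite half2 mul1r.
Qed.

Lemma node_moment0 z :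
  \sum_(k < K.+3) bernstein K.+2 (half * (s * (s + z))) (half * (s * (s - z))) k =
  s ^+ (2 * K.+2).
Proof. by rewrite bernstein_sum half_sum exprM. Qed.

Let Kinv : B := iota K.+2%:R^-1.

Lemma KinvK : Kinv * K.+2%:R = 1.
Proof. by rewrite /Kinv -(rmorph_nat iota) -rmorphM mulVf ?rmorph1 ?pnatr_eq0. Qed.

Lemma iota_node k : iota (node k) = Kinv * (2 * k%:R - K.+2%:R).
Proof. by rewrite /node rmorphM rmorphB rmorphM !rmorph_nat mulrC. Qed.

Lemma node_moment1 z :
  \sum_(k < K.+3) iota (node k) *
    bernstein K.+2 (half * (s * (s + z))) (half * (s * (s - z))) k =
  s ^+ (2 * K.+2).-1 * z.
Proof.
set a := half * _; set b := half * _.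
transitivity (Kinv * (2 * \sum_(k < K.+3) k%:R * bernstein K.+2 a b k -
   K.+2%:R * \sum_(k < K.+3) bernstein K.+2 a b k)).
  rewrite !mulr_sumr -sumrB mulr_sumr; apply: eq_bigr => k _.
  by rewrite iota_node; ring.
rewrite bernstein_sum1 bernstein_sum.
transitivity (Kinv * K.+2%:R * ((a - b) * (a + b) ^+ K.+1)).
  by rewrite [(a + b) ^+ K.+2]exprS; ring.
rewrite KinvK mul1r half_sum -exprM.
have -> : a - b = s * z.
  transitivity (half * 2 * (s * z)); first by rewrite /a /b; ring.
  by rewrite half2 mul1r.
have -> : (2 * K.+2).-1 = (2 * K.+1).+1 by rewrite mulnS.
by rewrite exprS; ring.
Qed.

(** The variance 1 / (K + 2) of the nodes around x_i / s at x_i = 0 appears as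
    the deviation of the second moment from x_i^2. *)
Lemma node_moment2 z :
  \sum_(k < K.+3) iota (node k ^+ 2) *
    bernstein K.+2 (half * (s * (s + z))) (half * (s * (s - z))) k =
  Kinv * s ^+ (2 * K.+2) + (1 - Kinv) * s ^+ (2 * K.+1) * z ^+ 2.
Proof.
set a := half * _; set b := half * _.
transitivity (Kinv ^+ 2 * (4 * \sum_(k < K.+3) k%:R ^+ 2 * bernstein K.+2 a b k -
   4 * K.+2%:R * (\sum_(k < K.+3) k%:R * bernstein K.+2 a b k) +
   K.+2%:R ^+ 2 * \sum_(k < K.+3) bernstein K.+2 a b k)).
  rewrite !mulr_sumr -sumrB -big_split mulr_sumr; apply: eq_bigr => k _.
  by rewrite rmorphXn iota_node /=; ring.
rewrite bernstein_sum1 bernstein_sum bernstein_sum2.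
transitivity (Kinv * K.+2%:R * Kinv * ((a + b) ^+ K *
   (K.+1%:R * (a - b) ^+ 2 + (a + b) ^+ 2))).
  by rewrite !exprS -[K.+2]addn1 -[K.+1]addn1 !natrD; ring.
rewrite KinvK mul1r half_sum -exprM.
have -> : a - b = s * z.
  transitivity (half * 2 * (s * z)); first by rewrite /a /b; ring.
  by rewrite half2 mul1r.
have -> : (1 - Kinv) = Kinv * K.+1%:R.
  by have := KinvK; rewrite -[K.+2]addn1 natrD mulrDr mulr1 => E;
    apply: (addIr Kinv); rewrite subrK -[LHS]E.
rewrite !mulnS !exprD !expr2; ring.
Qed.

Lemma sum_weight (f : option 'I_n -> R) (h : 'I_K.+3 -> R) (e : bool -> R) :
  \sum_w iota (f w.1.1 * h w.1.2 * e w.2) * weight w =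
  \sum_o iota (f o) * coord o ^+ 2 *
    (\sum_(k < K.+3) iota (h k) * bernstein K.+2 (half * (s * (s + coord o)))
                                        (half * (s * (s - coord o))) k) *
    \sum_c iota (e c) * (half * (s * (s + iota (sign c) * x0))).
Proof.
rewrite -(pair_bigA _ (fun p c => iota (f p.1 * h p.2 * e c) * weight (p, c))) /=.
rewrite -(pair_bigA _ (fun o k => \sum_c iota (f o * h k * e c) * weight ((o, k), c))) /=.
apply: eq_bigr => o _; rewrite [X in _ = X * _]mulr_sumr mulr_suml; apply: eq_bigr => k _.
rewrite mulr_sumr; apply: eq_bigr => c _.
by rewrite !rmorphM /weight /=; ring.
Qed.

Lemma sign_moment0 : \sum_c iota 1 * (half * (s * (s + iota (sign c) * x0))) = s ^+ 2.
Proof.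
by rewrite big_bool /= rmorphN rmorph1 !mul1r mulN1r half_sum.
Qed.

Lemma sign_moment1 :
  \sum_c iota (sign c) * (half * (s * (s + iota (sign c) * x0))) = s * x0.
Proof.
rewrite big_bool /= rmorphN rmorph1.
transitivity (half * 2 * (s * x0)); first by ring.
by rewrite half2 mul1r.
Qed.

(** The weights of the letters sum up to s^(excess + 1). *)
Definition excess : nat := (2 * K.+2 + 3)%N.
Let N := excess.

Lemma sum_coord2 : \sum_o coord o ^+ 2 = s ^+ 2.
Proof.
rewrite sphere (bigD1 None) //=; congr (_ + _).
rewrite (reindex_omap Some id) //=; last by case.
by apply: eq_bigl => i; rewrite eqxx.
Qed.

Lemma weight_sum : \sum_w weight w = s ^+ N.+1.
Proof.
have := sum_weight (fun=> 1) (fun=> 1) (fun=> 1).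
rewrite !mulr1 sign_moment0.
under eq_bigr => w _ do rewrite rmorph1 mul1r.
move=> ->.
rewrite -mulr_suml.
under eq_bigr => o _.
  under eq_bigr => k _ do rewrite rmorph1 mul1r.
  rewrite rmorph1 mul1r node_moment0; over.
rewrite -mulr_suml sum_coord2 /N /excess -!exprD; congr (_ ^+ _).
by lia.
Qed.


Lemma sos_half z : is_sos (s ^+ 2 - z ^+ 2) -> is_sos (half * (s * (s + z))).
Proof.
move=> sz.
have -> : half * (s * (s + z)) =
    (half * half) * ((s + z) ^+ 2 + (s ^+ 2 - z ^+ 2)).
  transitivity (half * (half * 2) * (s * (s + z))); last by ring.
  by rewrite half2 mulr1.
apply: sosM; last exact/sosD/sz/sos_sqr.
by rewrite -expr2; exact: sos_sqr.
Qed.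

Lemma sos_sub_coord o : is_sos (s ^+ 2 - coord o ^+ 2).
Proof.
rewrite -sum_coord2 (bigD1 o) //= addrAC subrr add0r.
by apply: sos_sum => o' _; exact: sos_sqr.
Qed.

(** On the sphere, s^2 minus the square of one coordinate is the sum of the
    squares of the others. *)
Lemma sos_weight w : is_sos (weight w).
Proof.
have sosN z : is_sos (s ^+ 2 - z ^+ 2) -> is_sos (half * (s * (s - z))).
  by rewrite -[z ^+ 2]sqrrN; exact: sos_half.
rewrite /weight; apply: sosM; first apply: sosM; first exact: sos_sqr.
  apply: sosM; first by rewrite -(rmorph_nat iota); apply: sos_nat.
  apply: sosM; apply: sosX; first exact/sos_half/sos_sub_coord.
  exact/sosN/sos_sub_coord.
have := sos_sub_coord None; case: w.2 => /= s0.
  by rewrite rmorph1 mul1r; exact: sos_half.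
by rewrite rmorphN rmorph1 mulN1r; exact: sosN.
Qed.

Local Notation rep := (represents iota weight s N).

Lemma block_moment o (h : 'I_K.+3 -> R) :
  \sum_w iota ((block_of w == o)%:R * h w.1.2) * weight w =
  coord o ^+ 2 * (\sum_(k < K.+3) iota (h k) *
     bernstein K.+2 (half * (s * (s + coord o))) (half * (s * (s - coord o))) k) *
  s ^+ 2.
Proof.
have := sum_weight (fun o' => (o' == o)%:R) h (fun=> 1).
under eq_bigr => w _ do rewrite mulr1.
move=> ->; rewrite -mulr_suml sign_moment0 (bigD1 o) //= eqxx rmorph1 mul1r.
rewrite [X in _ + X]big1 ?addr0 // => o' /negPf->.
by rewrite rmorph0 !mul0r.
Qed.

Definition sign0 (t : letter -> R) : R := \sum_w sign w.2 * t w.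
Definition mass0 (t : letter -> R) : R := \sum_w (block_of w == None)%:R * t w.
Definition mass i (t : letter -> R) : R :=
  \sum_w (block_of w == Some i)%:R * t w.
Definition drift i (t : letter -> R) : R :=
  \sum_w ((block_of w == Some i)%:R * mark w) * t w.
Definition energy i (t : letter -> R) : R :=
  \sum_w ((block_of w == Some i)%:R * mark w ^+ 2) * t w.

Lemma normr_node k : `|node k| <= 1.
Proof.
have K0 : (0 : R) < K.+2%:R by rewrite ltr0n.
have kK : k%:R <= K.+2%:R :> R by rewrite ler_nat -ltnS ltn_ord.
have k0 : 0 <= k%:R :> R by rewrite ler0n.
rewrite /node normrM normfV (gtr0_norm K0) ler_pdivrMr // mul1r.
by rewrite ler_norml; apply/andP; split; lra.
Qed.

Let norm_ind (b : bool) (c : R) : `|c| <= 1 -> `|b%:R * c| <= 1.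
Proof. by case: b; rewrite ?mul1r // mul0r normr0 ler01. Qed.

Lemma represents_sign0 : rep predT 1 1 sign0 x0.
Proof.
apply: represents_linear => // [|w|]; first exact: weight_sum.
  by case: w.2; rewrite ?normrN normr1.
have := sum_weight (fun=> 1) (fun=> 1) sign.
under eq_bigr => w _ do rewrite !mul1r.
move=> ->; rewrite sign_moment1 expr0 mul1r -mulr_suml.
under eq_bigr => o _.
  under eq_bigr => k _ do rewrite rmorph1 mul1r.
  rewrite rmorph1 mul1r node_moment0; over.
rewrite -mulr_suml sum_coord2 mulrA -exprD -exprSr; congr (_ ^+ _ * _).
by rewrite /N /excess; lia.
Qed.

Lemma represents_mass0 : rep predT 2 1 mass0 (x0 ^+ 2).
Proof.
apply: represents_linear => // [|w|]; first exact: weight_sum.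
  by rewrite -[_%:R]mulr1; apply: norm_ind; rewrite normr1.
have := block_moment None (fun=> 1).
under eq_bigr => w _ do rewrite mulr1.
move=> ->; under eq_bigr => k _ do rewrite rmorph1 mul1r.
rewrite node_moment0 /N /excess !exprD /=; ring.
Qed.

Lemma represents_mass i :
  rep [pred w | block_of w == Some i] 2 1 (mass i) (x i ^+ 2).
Proof.
apply: represents_linear => // [|w|w /negPf /= ->|] //; first exact: weight_sum.
  by rewrite -[_%:R]mulr1; apply: norm_ind; rewrite normr1.
have := block_moment (Some i) (fun=> 1).
under eq_bigr => w _ do rewrite mulr1.
move=> ->; under eq_bigr => k _ do rewrite rmorph1 mul1r.
rewrite node_moment0 /N /excess !exprD /=; ring.
Qed.

Lemma represents_drift i :
  rep [pred w | block_of w == Some i] 3 1 (drift i) (x i ^+ 3).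
Proof.
apply: represents_linear => // [|w|w /negPf /= ->|]; first exact: weight_sum.
- exact/norm_ind/normr_node.
- by rewrite mul0r.
rewrite block_moment node_moment1 /N /excess /=.
have -> : (2 * K.+2 + 3 = 2 + (2 * K.+2).-1 + 2)%N by lia.
by rewrite !exprD; ring.
Qed.

Lemma represents_energy i :
  rep [pred w | block_of w == Some i] 4 1 (energy i)
    (Kinv * s ^+ 2 * x i ^+ 2 + (1 - Kinv) * x i ^+ 4).
Proof.
apply: represents_linear => // [|w|w /negPf /= ->|]; first exact: weight_sum.
- by apply: norm_ind; rewrite normrX expr_le1 // normr_node.
- by rewrite mul0r.
rewrite (block_moment (Some i) (fun k => node k ^+ 2)) node_moment2 /N /excess.
by rewrite !mulnS !exprD /=; ring.
Qed.

(** The summand of p_j belonging to x_i, written in x_i^2 and x_i^3. No such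
    expression exists for j = 1. *)
Definition block_power j i (t : letter -> R) : R :=
  (if odd j then drift i t else mass i t) * mass i t ^+ (j - 2)./2.

Definition block_powersum j (t : letter -> R) : R := \sum_i block_power j i t.

Lemma represents_block_powersum j : (1 < j)%N ->
  rep predT j 1 (block_powersum j) (\sum_i x i ^+ j).
Proof.
move=> j1; case: j j1 => // j j1.
apply: (represents_blocks (block_of := block_of)) => // i.
have repm := represents_predT (represents_mass i).
have repX := representsX weight_sum (j.+1 - 2)./2 repm.
case: (boolP (odd j.+1)) => oj.
  apply: (represents_conv (representsM_head (represents_drift i) repX)).
  - by move: oj; lia.
  - by rewrite expr1n mulr1.
  - by move=> t _; rewrite /block_power oj.
  by rewrite -exprM -exprD; congr (_ ^+ _); move: oj; lia.
apply: (represents_conv (representsM_head (represents_mass i) repX)).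
- by move: oj; lia.
- by rewrite expr1n mulr1.
- by move=> t _; rewrite /block_power (negPf oj).
by rewrite -exprM -exprD; congr (_ ^+ _); move: oj; lia.
Qed.

(** The penalties express that the elements obtained for x_0 and x_i^3 have the
    squares x_0^2 and (x_i^2)^3, and that the second moment of the nodes is the
    one computed in [node_moment2]. All this holds in the ring, but not on the
    simplex. The last one is linear in the letters: it controls the
    many coordinates that are individually too small to be seen by the second. *)
Definition penalty0 (t : letter -> R) : R := (sign0 t ^+ 2 - mass0 t) ^+ 2.
Definition penalty1 (t : letter -> R) : R :=
  \sum_i (drift i t ^+ 2 - mass i t ^+ 3) ^+ 2.
Definition penalty2 (t : letter -> R) : R :=
  \sum_i (energy i t - (K.+2%:R^-1 * mass i t + (1 - K.+2%:R^-1) * mass i t ^+ 2)).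

Lemma represents_penalty0 : rep predT 4 4 penalty0 0.
Proof.
have r1 := representsX weight_sum 2 represents_sign0.
have r2 := representsZ (-1) represents_mass0.
have r := representsX weight_sum 2 (representsD r1 r2).
apply: represents_conv r _ _ _ _ => //.
- by rewrite normrN !normr1 expr1n; lra.
- by move=> t _; rewrite /penalty0 mulN1r.
by rewrite rmorphN rmorph1 mulN1r subrr expr0n.
Qed.

Lemma represents_penalty1 : rep predT 12 4 penalty1 0.
Proof.
have -> : (0 : B) = \sum_(i < n) 0 by rewrite big1.
apply: (represents_blocks (block_of := block_of)) => // i.
have rd := represents_drift i; have rm := represents_mass i.
have r1 := representsM_head rd (represents_predT rd).
have r2 := representsM_head rm (representsX weight_sum 2 (represents_predT rm)).
have r3 := representsD r1 (representsZ (-1) r2).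
have r := representsM_head r3 (represents_predT r3).
apply: represents_conv r _ _ _ _ => //.
- by rewrite normrN !normr1 expr1n; lra.
- by move=> t _; ring.
by rewrite rmorphN rmorph1; ring.
Qed.

Lemma represents_penalty2 : rep predT 4 4 penalty2 0.
Proof.
have -> : (0 : B) = \sum_(i < n) 0 by rewrite big1.
apply: (represents_blocks (block_of := block_of)) => // i.
have re := represents_energy i; have rm := represents_mass i.
have r1 := representsM_head rm (represents1 iota weight_sum 2).
have r2 := representsM_head rm (represents_predT rm).
have r := representsD re (representsD (representsZ (- K.+2%:R^-1) r1)
   (representsZ (- (1 - K.+2%:R^-1)) r2)).
apply: represents_conv r _ _ _ _ => //.
- have K0 : 0 <= (K.+2%:R^-1 : R) by rewrite invr_ge0 ler0n.
  have K1 : (K.+2%:R^-1 : R) <= 1 by rewrite invf_le1 ?ltr0n // ler1n.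
  move: (_^-1) K0 K1 => k k0 k1.
  by rewrite !normrN (ger0_norm k0) ger0_norm ?subr_ge0 //; lra.
- by move=> t _; ring.
by rewrite !rmorphN rmorphB rmorph1 -/Kinv; ring.
Qed.

End Letters.

(** * Elementary inequalities *)

Section Scalars.
Variable R : rcfType.
Implicit Types (a b r eta delta : R).

(** If r^2 <= eta, the left side is at most r^4 <= eta r^2. Otherwise r^6 - d^2
    is at least eta times the left side when the latter is positive. *)
Lemma root_gap r (d : R) eta : 0 < eta -> 0 <= r -> 0 <= d ->
  r * (r ^+ 3 - d) <=
    eta * r ^+ 2 + (2 * eta ^+ 4)^-1 * (d ^+ 2 - r ^+ 6) ^+ 2.
Proof.
move=> eta0 r0 d0; set Z := d ^+ 2 - r ^+ 6; set c := _^-1.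
have c0 : 0 < c by rewrite invr_gt0 mulr_gt0 // exprn_gt0.
have cE : c * (2 * eta ^+ 4) = 1 by rewrite mulVf // gt_eqF // mulr_gt0 // exprn_gt0.
have cZ : 0 <= c * Z ^+ 2 by rewrite mulr_ge0 ?sqr_ge0 // ltW.
have rr0 : 0 <= r ^+ 2 by rewrite exprn_ge0.
have [reta|etar] := lerP (r ^+ 2) eta.
  have h1 : r ^+ 2 * r ^+ 2 <= eta * r ^+ 2 by rewrite ler_wpM2r.
  have h2 : 0 <= r * d by rewrite mulr_ge0.
  have -> : r * (r ^+ 3 - d) = r ^+ 2 * r ^+ 2 - r * d by ring.
  lra.
have [rd|dr] := lerP (r ^+ 3) d.
  have h1 : r * (r ^+ 3 - d) <= 0 by rewrite mulr_ge0_le0 // subr_le0.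
  have h2 : 0 <= eta * r ^+ 2 by rewrite mulr_ge0 // ltW.
  lra.
set a := r * (r ^+ 3 - d).
have a0 : 0 <= a by rewrite mulr_ge0 // subr_ge0 ltW.
have Za : eta * a <= - Z.
  apply: le_trans (_ : r ^+ 2 * a <= _); first by rewrite ler_wpM2r // ltW.
  have -> : - Z = r ^+ 2 * a + d * (r ^+ 3 - d) by rewrite /Z /a; ring.
  by rewrite lerDl mulr_ge0 // subr_ge0 ltW.
have h1 : eta * eta <= eta * r ^+ 2 by rewrite ler_pM2l // ltW.
have h2 : (eta * a) ^+ 2 <= Z ^+ 2.
  have ea0 : 0 <= eta * a by rewrite mulr_ge0 // ltW.
  by rewrite -[leRHS]sqrrN ler_pXn2r // nnegrE // (le_trans ea0 Za).
have h3 : c * (eta * a) ^+ 2 <= c * Z ^+ 2 by rewrite ler_pM2l.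
have h4 : 0 <= c * (eta * a - eta ^+ 3) ^+ 2 by rewrite mulr_ge0 ?sqr_ge0 // ltW.
have E : c * (eta * a - eta ^+ 3) ^+ 2 =
  c * (eta * a) ^+ 2 - c * (2 * eta ^+ 4) * a + c * (2 * eta ^+ 4) * (eta * eta / 2).
  by field.
have h5 : 0 <= eta * eta by rewrite mulr_ge0 // ltW.
rewrite cE !mul1r in E; lra.
Qed.

Lemma sqr_gap a b delta : 0 < delta -> 0 <= a -> 0 <= b ->
  `|a - b| <= delta + (delta ^+ 3)^-1 * (a ^+ 2 - b ^+ 2) ^+ 2.
Proof.
move=> delta0 a0 b0; set u := `|a - b|; set c := _^-1.
have d30 : 0 < delta ^+ 3 by rewrite exprn_gt0.
have c0 : 0 < c by rewrite invr_gt0.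
have u0 : 0 <= u by rewrite normr_ge0.
have [ud|du] := lerP u delta.
  by rewrite (le_trans ud) // lerDl mulr_ge0 ?sqr_ge0 // ltW.
have uab : u <= a + b by rewrite ler_norml; apply/andP; split; lra.
have h : (u * u) ^+ 2 <= (a ^+ 2 - b ^+ 2) ^+ 2.
  have -> : (a ^+ 2 - b ^+ 2) ^+ 2 = (u * (a + b)) ^+ 2.
    by rewrite subr_sqr !exprMn real_normK ?num_real.
  by rewrite ler_pXn2r ?nnegrE ?mulr_ge0 ?addr_ge0 // ler_wpM2l.
have h2 : delta ^+ 3 * u <= (u * u) ^+ 2.
  have -> : (u * u) ^+ 2 = u ^+ 3 * u by ring.
  by rewrite ler_wpM2r // lerXn2r ?nnegrE // ltW.
have h3 : u <= c * (a ^+ 2 - b ^+ 2) ^+ 2.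
  by rewrite /c mulrC ler_pdivlMr // mulrC (le_trans h2).
by rewrite (le_trans h3) // lerDr ltW.
Qed.

Lemma amgm_norm a delta : 0 < delta ->
  `|a| <= delta / 2 + (2 * delta)^-1 * a ^+ 2.
Proof.
move=> delta0; have d2 : 0 < 2 * delta by rewrite mulr_gt0.
have dn0 : delta != 0 by rewrite gt_eqF.
have E : 2 * delta * (delta / 2 + (2 * delta)^-1 * a ^+ 2) = delta ^+ 2 + a ^+ 2.
  by field.
rewrite -(ler_pM2l d2) E.
have -> : a ^+ 2 = `|a| ^+ 2 by rewrite real_normK ?num_real.
have := sqr_ge0 (`|a| - delta).
rewrite sqrrB; lra.
Qed.

(** Two numbers of [-1, 1] at distance at most d times rho: a multiplicative
    substitute for a Lipschitz estimate on monomials. *)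
Definition close (rho : R) (d : nat) a b :=
  [/\ `|a| <= 1, `|b| <= 1 & `|a - b| <= d%:R * rho].

Lemma close1 rho : close rho 0 1 1.
Proof. by rewrite /close normr1 subrr normr0 mul0r. Qed.

Lemma closeM (rho : R) d e a b a' b' :
  close rho d a b -> close rho e a' b' -> close rho (d + e) (a * a') (b * b').
Proof.
move=> [a1 b1 ab] [a'1 b'1 ab']; split.
- by rewrite normrM mulr_ile1.
- by rewrite normrM mulr_ile1.
have -> : a * a' - b * b' = (a - b) * a' + b * (a' - b') by ring.
rewrite natrD [leRHS]mulrDl (le_trans (ler_normD _ _)) // !normrM lerD //.
  by rewrite -[leRHS]mulr1 ler_pM.
by rewrite -[leRHS]mul1r ler_pM.
Qed.

Lemma closeX rho d a b k : close (rho : R) d a b -> close rho (d * k) (a ^+ k) (b ^+ k).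
Proof.
move=> ab; elim: k => [|k IHk]; first by rewrite muln0; exact: close1.
by rewrite mulnS !exprS; exact: closeM.
Qed.

Lemma close_prod rho (I : eqType) (s : seq I) (d : I -> nat) (a b : I -> R) :
  (forall i, i \in s -> close rho (d i) (a i) (b i)) ->
  close rho (\sum_(i <- s) d i) (\prod_(i <- s) a i) (\prod_(i <- s) b i).
Proof.
elim: s => [|i s IHs] ab; first by rewrite !big_nil; exact: close1.
rewrite !big_cons; apply: closeM; first exact: ab (mem_head i s).
by apply: IHs => j js; apply: ab; rewrite inE js orbT.
Qed.

Lemma close_weaken (rho : R) d e a b :
  0 <= rho -> (d <= e)%N -> close rho d a b -> close rho e a b.
Proof.
move=> rho0 de [a1 b1 ab]; split=> //; apply: le_trans ab _.
by rewrite ler_wpM2r // ler_nat.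
Qed.

End Scalars.

(** * From the simplex to the sphere *)

Section Rounding.
Variables (R : rcfType) (n K : nat).
Local Notation W := (letter n K).
Variables (t : W -> R) (t_simplex : simplex t).

Let t0 w : 0 <= t w. Proof. by have [] := t_simplex. Qed.
Let t1 : \sum_w t w = 1. Proof. by have [] := t_simplex. Qed.

Lemma mass_ge0 i : 0 <= mass i t.
Proof. by apply: sumr_ge0 => w _; rewrite mulr_ge0 ?ler0n. Qed.

Lemma mass0_ge0 : 0 <= mass0 t.
Proof. by apply: sumr_ge0 => w _; rewrite mulr_ge0 ?ler0n. Qed.

Lemma sum_mass : mass0 t + \sum_i mass i t = 1.
Proof.
rewrite -t1 /mass exchange_big -big_split; apply: eq_bigr => w _ /=.
rewrite -mulr_suml -mulrDl; case: (block_of w) => [i|] /=.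
  rewrite add0r (bigD1 i) //= eqxx big1 ?addr0 ?mul1r // => j ji.
  by rewrite (inj_eq Some_inj) eq_sym (negPf ji).
by rewrite big1 ?addr0 ?mul1r.
Qed.

Lemma sum_mass_le1 : \sum_i mass i t <= 1.
Proof. by have := sum_mass; have := mass0_ge0; lra. Qed.

Lemma mass_le1 i : mass i t <= 1.
Proof.
apply: le_trans sum_mass_le1; rewrite (bigD1 i) //= lerDl.
by apply: sumr_ge0 => j _; exact: mass_ge0.
Qed.

Lemma normr_drift i : `|drift i t| <= mass i t.
Proof.
rewrite /drift /mass (le_trans (ler_norm_sum _ _ _)) //; apply: ler_sum => w _.
rewrite 2!normrM (ger0_norm (t0 w)) ler_wpM2r // normr_nat.
by rewrite -[leRHS]mulr1 ler_wpM2l ?ler0n //; exact: normr_node.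
Qed.

Lemma normr_sign0 : `|sign0 t| <= 1.
Proof.
rewrite -t1 /sign0 (le_trans (ler_norm_sum _ _ _)) //; apply: ler_sum => w _.
rewrite normrM (ger0_norm (t0 w)); case: w.2; by rewrite ?normrN normr1 mul1r.
Qed.

(** Letterwise, |y - z| <= delta / 2 + (y - z)^2 / (2 delta). *)
Lemma drift_gap i z delta : 0 < delta ->
  `|drift i t - z * mass i t| <= delta / 2 * mass i t +
    (2 * delta)^-1 * (energy i t - 2 * z * drift i t + z ^+ 2 * mass i t).
Proof.
move=> delta0.
have -> : drift i t - z * mass i t =
    \sum_w (block_of w == Some i)%:R * (mark R w - z) * t w.
  by rewrite /mass mulr_sumr -sumrB; apply: eq_bigr => w _; ring.
have -> : delta / 2 * mass i t + (2 * delta)^-1 *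
      (energy i t - 2 * z * drift i t + z ^+ 2 * mass i t) =
    \sum_w (block_of w == Some i)%:R *
       (delta / 2 + (2 * delta)^-1 * (mark R w - z) ^+ 2) * t w.
  rewrite /energy /drift /mass !mulr_sumr -sumrB -big_split mulr_sumr -big_split.
  by apply: eq_bigr => w _ /=; ring.
rewrite (le_trans (ler_norm_sum _ _ _)) //; apply: ler_sum => w _.
rewrite !normrM (ger0_norm (t0 w)) ler_wpM2r // normr_nat ler_wpM2l ?ler0n //.
exact: amgm_norm.
Qed.

(** At a = 0 the positive root is chosen, so that the square is always m. *)
Definition signed_root (a m : R) : R := if 0 <= a then Num.sqrt m else - Num.sqrt m.

Lemma signed_root_sqr a m : 0 <= m -> signed_root a m ^+ 2 = m.
Proof. by move=> m0; rewrite /signed_root; case: ifP; rewrite ?sqrrN sqr_sqrtr. Qed.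

Lemma signed_rootM a m : signed_root a m * a = Num.sqrt m * `|a|.
Proof.
rewrite /signed_root; case: ifPn => [a0|]; first by rewrite ger0_norm.
by rewrite -ltNge => a0; rewrite ltr0_norm // mulrN mulNr.
Qed.

Lemma signed_rootB a m : `|a - signed_root a m| = `| `|a| - Num.sqrt m|.
Proof.
rewrite /signed_root; case: ifPn => [a0|]; first by rewrite [ `|a| ]ger0_norm.
by rewrite -ltNge => a0; rewrite (ltr0_norm a0) opprK -opprD normrN.
Qed.

(** Taking the masses as squares puts the point on the sphere; the signs are
    those that bring its cubes closest to the drifts. *)
Definition rounded0 := signed_root (sign0 t) (mass0 t).
Definition rounded i := signed_root (drift i t) (mass i t).

Lemma rounded_sphere : rounded0 ^+ 2 + \sum_i rounded i ^+ 2 = 1.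
Proof.
rewrite -sum_mass signed_root_sqr ?mass0_ge0 //; congr (_ + _).
by apply: eq_bigr => i _; rewrite signed_root_sqr ?mass_ge0.
Qed.

Lemma rounded0_gap delta : 0 < delta ->
  `|sign0 t - rounded0| <= delta + (delta ^+ 3)^-1 * penalty0 t.
Proof.
move=> delta0; rewrite signed_rootB.
have := sqr_gap delta0 (normr_ge0 (sign0 t)) (sqrtr_ge0 (mass0 t)).
by rewrite sqr_sqrtr ?mass0_ge0 // real_normK ?num_real.
Qed.

(** By [drift_gap] it suffices to bound sum_i (energy_i + m_i^2 - 2 r_i |a_i|)
    with r_i = sqrt m_i. The last penalty replaces the energy by m_i^2, up to
    1 / (K + 2), and what remains is 2 r_i (r_i^3 - |a_i|), which [root_gap]
    bounds by the second penalty. *)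
Lemma sum_rounded_gap delta : 0 < delta -> K.+2%:R^-1 <= delta ^+ 2 ->
  \sum_i `|drift i t - rounded i * mass i t| <=
  3 / 2 * delta + 8 / delta ^+ 9 * penalty1 t + (2 * delta)^-1 * penalty2 t.
Proof.
move=> delta0 Kdelta; set kap := K.+2%:R^-1 in Kdelta *.
have kap0 : 0 <= kap by rewrite invr_ge0 ler0n.
pose gap i := energy i t - 2 * rounded i * drift i t + rounded i ^+ 2 * mass i t.
have gapE i : gap i =
    (energy i t - (kap * mass i t + (1 - kap) * mass i t ^+ 2)) + kap * mass i t
    - kap * mass i t ^+ 2 +
    2 * (Num.sqrt (mass i t) * (Num.sqrt (mass i t) ^+ 3 - `|drift i t|)).
  have -> : gap i = energy i t - 2 * (rounded i * drift i t) + rounded i ^+ 2 * mass i t.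
    by rewrite /gap mulrA.
  rewrite signed_rootM signed_root_sqr ?mass_ge0 //.
  have -> : Num.sqrt (mass i t) * (Num.sqrt (mass i t) ^+ 3 - `|drift i t|) =
    (Num.sqrt (mass i t) ^+ 2) ^+ 2 - Num.sqrt (mass i t) * `|drift i t| by ring.
  by rewrite sqr_sqrtr ?mass_ge0 //; ring.
(* With this eta, the error terms 1 / (K + 2) and 2 eta both contribute at
   most delta / 2 after division by 2 delta. *)
pose eta := delta ^+ 2 / 2.
have eta0 : 0 < eta by rewrite divr_gt0 ?exprn_gt0.
have gap_le i : gap i <=
    (energy i t - (kap * mass i t + (1 - kap) * mass i t ^+ 2)) + kap * mass i t
    + 2 * (eta * mass i t + (2 * eta ^+ 4)^-1 * (drift i t ^+ 2 - mass i t ^+ 3) ^+ 2).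
  rewrite gapE.
  have := root_gap eta0 (sqrtr_ge0 (mass i t)) (normr_ge0 (drift i t)).
  rewrite real_normK ?num_real // (exprM _ 2 3) sqr_sqrtr ?mass_ge0 //.
  have : 0 <= kap * mass i t ^+ 2 by rewrite mulr_ge0 ?sqr_ge0.
  lra.
have sum_gap : \sum_i gap i <=
    penalty2 t + kap + 2 * (eta + (2 * eta ^+ 4)^-1 * penalty1 t).
  apply: le_trans (ler_sum _ (fun i _ => gap_le i)) _.
  rewrite 2!big_split /= -/(penalty2 t) -!mulr_sumr big_split /= -!mulr_sumr.
  have := sum_mass_le1; set S := \sum_i _ => S1.
  have k1 : kap * S <= kap by rewrite -[leRHS]mulr1 ler_wpM2l.
  have e1 : eta * S <= eta by rewrite -[leRHS]mulr1 ler_wpM2l // ltW.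
  by rewrite -/(penalty1 t); lra.
apply: le_trans (ler_sum _ (fun i _ => drift_gap i (rounded i) delta0)) _.
rewrite big_split /= -!mulr_sumr -/(gap _).
have h1 : delta / 2 * \sum_i mass i t <= delta / 2.
  by rewrite -[leRHS]mulr1 ler_wpM2l ?sum_mass_le1 // divr_ge0 // ltW.
have d0 : delta != 0 by rewrite gt_eqF.
have h2 : (2 * delta)^-1 * \sum_i gap i <= (2 * delta)^-1 *
    (penalty2 t + delta ^+ 2 + 2 * (eta + (2 * eta ^+ 4)^-1 * penalty1 t)).
  rewrite ler_wpM2l ?invr_ge0 ?mulr_ge0 ?(ltW delta0) //; lra.
have E : (2 * delta)^-1 *
    (penalty2 t + delta ^+ 2 + 2 * (eta + (2 * eta ^+ 4)^-1 * penalty1 t)) =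
    delta + 8 / delta ^+ 9 * penalty1 t + (2 * delta)^-1 * penalty2 t.
  rewrite /eta; by field.
rewrite E in h2; lra.
Qed.

Lemma block_powersum_gap j : (1 < j)%N ->
  `|block_powersum j t - \sum_i rounded i ^+ j| <=
  \sum_i `|drift i t - rounded i * mass i t|.
Proof.
move=> j1; rewrite /block_powersum -sumrB (le_trans (ler_norm_sum _ _ _)) //.
apply: ler_sum => i _; rewrite /block_power.
have r2 : rounded i ^+ 2 = mass i t by rewrite signed_root_sqr ?mass_ge0.
case: ifPn => oj.
  have -> : rounded i ^+ j = rounded i * mass i t * mass i t ^+ (j - 2)./2.
    by rewrite -r2 -exprS -exprM -exprD; congr (_ ^+ _); move: oj; lia.
  rewrite -mulrBl normrM -[leRHS]mulr1 ler_wpM2l // normrX.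
  by rewrite exprn_ile1 // ger0_norm ?mass_ge0 // mass_le1.
have -> : rounded i ^+ j = mass i t * mass i t ^+ (j - 2)./2.
  by rewrite -r2 -exprM -exprD; congr (_ ^+ _); move: oj; lia.
by rewrite subrr normr0.
Qed.

Lemma normr_block_powersum j : `|block_powersum j t| <= 1.
Proof.
apply: le_trans (ler_norm_sum _ _ _) _; apply: le_trans _ sum_mass_le1.
apply: ler_sum => i _; rewrite /block_power normrM -[leRHS]mulr1 ler_pM //.
  by case: ifP => _; rewrite ?normr_drift // ger0_norm ?mass_ge0.
by rewrite normrX exprn_ile1 // ger0_norm ?mass_ge0 ?mass_le1.
Qed.

Lemma normr_sum_rounded j : (1 < j)%N -> `|\sum_i rounded i ^+ j| <= 1.
Proof.
move=> j1; apply: le_trans (ler_norm_sum _ _ _) _; apply: le_trans _ sum_mass_le1.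
apply: ler_sum => i _.
have r2 : rounded i ^+ 2 = mass i t by rewrite signed_root_sqr ?mass_ge0.
have -> : j = (2 + (j - 2))%N by lia.
rewrite exprD r2 normrM -[leRHS]mulr1 ler_pM //; first by rewrite ger0_norm ?mass_ge0.
rewrite normrX exprn_ile1 //.
by rewrite -(@ler_pXn2r _ 2) ?nnegrE // real_normK ?num_real // expr1n r2 mass_le1.
Qed.

Lemma normr_rounded0 : `|rounded0| <= 1.
Proof.
rewrite -(@ler_pXn2r _ 2) ?nnegrE // real_normK ?num_real // expr1n.
rewrite signed_root_sqr ?mass0_ge0 //.
have := sum_mass; have : 0 <= \sum_i mass i t.
  by apply: sumr_ge0 => i _; exact: mass_ge0.
lra.
Qed.

End Rounding.

(** * Adjoining a square root *)

(** The ring A[s] / (s^2 - q); the pair (a, b) stands for a + b s. *)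
Definition sqrt_ext (A : comNzRingType) (q : A) : Type := (A * A)%type.

Section SqrtExtension.
Variables (A : comNzRingType) (q : A).
Local Notation B := (sqrt_ext q).

HB.instance Definition _ := GRing.Zmodule.copy B (A * A)%type.

Definition sqrt_ext_mul (u v : B) : B :=
  (u.1 * v.1 + q * (u.2 * v.2), u.1 * v.2 + u.2 * v.1).

Fact sqrt_ext_mulA : associative sqrt_ext_mul.
Proof. by move=> [a b] [c d] [e f]; congr pair => /=; ring. Qed.

Fact sqrt_ext_mulC : commutative sqrt_ext_mul.
Proof. by move=> [a b] [c d]; congr pair => /=; ring. Qed.

Fact sqrt_ext_mul1 : left_id (1, 0) sqrt_ext_mul.
Proof. by move=> [a b]; congr pair => /=; ring. Qed.

Fact sqrt_ext_mulDl : left_distributive sqrt_ext_mul +%R.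
Proof. by move=> [a b] [c d] [e f]; congr pair => /=; ring. Qed.

Fact sqrt_ext_1neq0 : (1, 0) != 0 :> B.
Proof. by apply/eqP => -[/eqP]; rewrite oner_eq0. Qed.

HB.instance Definition _ := GRing.Zmodule_isComNzRing.Build B
  sqrt_ext_mulA sqrt_ext_mulC sqrt_ext_mul1 sqrt_ext_mulDl sqrt_ext_1neq0.

Definition sqrt_ext_in (a : A) : B := (a, 0).

Definition sqrt_gen : B := (0, 1).

Fact sqrt_ext_in_zmod : zmod_morphism sqrt_ext_in.
Proof. by move=> a b; congr pair => /=; rewrite subrr. Qed.

Fact sqrt_ext_in_monoid : monoid_morphism sqrt_ext_in.
Proof. by split=> // a b; congr pair => /=; ring. Qed.

HB.instance Definition _ :=
  GRing.isZmodMorphism.Build A B sqrt_ext_in sqrt_ext_in_zmod.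
HB.instance Definition _ :=
  GRing.isMonoidMorphism.Build A B sqrt_ext_in sqrt_ext_in_monoid.

Lemma sqrt_gen_sqr : sqrt_gen ^+ 2 = sqrt_ext_in q.
Proof. by rewrite expr2; congr pair => /=; ring. Qed.

Lemma sqrt_gen_even k (a : A) :
  sqrt_gen ^+ (2 * k) * sqrt_ext_in a = sqrt_ext_in (q ^+ k * a).
Proof. by rewrite exprM sqrt_gen_sqr rmorphM rmorphXn. Qed.

(** The component free of s of (a + b s)^2 is a^2 + q b^2. *)
Lemma sos_sqrt_ext (a : A) :
  is_sos q -> is_sos (sqrt_ext_in a) -> is_sos a.
Proof.
move=> sq [r /(congr1 fst) /= ->].
elim: r => [|u r IHr]; first by rewrite big_nil; exact: sos0.
rewrite big_cons; apply: sosD IHr => /=.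
apply: sosD; first by rewrite -expr2; exact: sos_sqr.
by apply: sosM => //; rewrite -expr2; exact: sos_sqr.
Qed.

End SqrtExtension.

(** * Homogenized symmetric functions *)

Lemma Xdeg_le (R : realType) (f : symfun R) m :
  m \in msupp f -> (Xdeg m <= symdeg f)%N.
Proof. by move=> mf; rewrite /symdeg (big_rem m) //= leq_maxl. Qed.

Lemma Xdeg1 : Xdeg mone = 0%N.
Proof. by rewrite /Xdeg mdom1 big_seq_fset0. Qed.

Section HomogeneousValue.
Variables (R : realType) (f : symfun R).

(** The homogenization as a polynomial in x_0 and arbitrary values p i of the
    power sums p_(i+1). *)
Definition homog_monomial (S : comNzRingType) (y0 : S) (p : nat -> S)
    (m : {cmonom nat}) : S :=
  y0 ^+ (symdeg f - Xdeg m) * mon_value p m.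

Definition homog_value (S : comNzRingType) (iota : {rmorphism R -> S}) (y0 : S)
    (p : nat -> S) : S :=
  \sum_(m <- msupp f) iota f@_m * homog_monomial y0 p m.

Lemma eval_homog_value (y0 : R) (y : finseq R) :
  eval_homog (homogenization f) y0 y =
  homog_value idfun y0 (fun i => \sum_(j <- finsupp y) y j ^+ i.+1).
Proof.
rewrite eval_homogE /homog_value.
under eq_bigr => j _ do rewrite /homcomp raddf_sum mulr_sumr.
rewrite (exchange_big_dep xpredT) //=; apply: eq_big_seq => m mf.
have mD : (Xdeg m < (symdeg f).+1)%N by rewrite ltnS Xdeg_le.
rewrite (big_pred1 (Ordinal mD)); last by move=> j; rewrite /= -val_eqE /= eq_sym.
by rewrite /symeval monalg.mmapU /homog_monomial /= mulrCA.
Qed.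

Lemma truncation_value (n : nat) (S : comNzRingType)
    (phi : {rmorphism mpoly n R -> S}) :
  phi (truncation n f) =
  homog_value (phi \o @mpolyC n R) 1
    (fun i => \sum_(j < n) phi (mpolyX R (mnm1 j)) ^+ i.+1).
Proof.
rewrite /truncation monalg.mmapE rmorph_sum; apply: eq_bigr => m _.
rewrite rmorphM /homog_monomial expr1n mul1r /=; congr (_ * _).
rewrite /mon_value rmorph_prod; apply: eq_bigr => i _.
rewrite rmorphXn rmorph_sum; congr (_ ^+ _); apply: eq_bigr => j _.
by rewrite rmorphXn.
Qed.

Definition coef_sum : R := \sum_(m <- msupp f) `|f@_m|.

(** A homogeneous function of odd degree changes sign between (1, 0) and
    (-1, 0). *)
Lemma homog_value_odd (r : nat -> R) :
  (forall i, r i = 0) -> odd (symdeg f) ->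
  homog_value idfun (-1) r = - homog_value idfun 1 r.
Proof.
move=> r0 oD; rewrite /homog_value -sumrN; apply: eq_bigr => m _.
rewrite -mulrN /homog_monomial expr1n mul1r; congr (_ * _).
have [->|m1] := eqVneq m mone.
  by rewrite Xdeg1 subn0 -signr_odd oD /mon_value mdom1 big_seq_fset0 mulr1.
have [i im] : exists i, i \in finsupp m.
  apply/fset0Pn; apply: contra_neq m1 => m0; apply/eqP/cmP => j.
  by rewrite cm1; apply/eqP; rewrite cmE_eq0 m0 inE.
have -> : mon_value r m = 0.
  rewrite /mon_value (big_rem i) //= r0 expr0n.
  by move: im; rewrite -cmE_neq0 => /negPf->; rewrite mul0r.
by rewrite mulr0 oppr0.
Qed.

Hypothesis f_p1_free : p1_free f.

Let supp_gt0 m i : m \in msupp f -> i \in finsupp m -> (0 < i)%N.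
Proof.
move=> mf; rewrite -cmE_neq0; case: i => // /eqP m0.
by case: m0; exact: f_p1_free.
Qed.

Let deg_split m : m \in msupp f ->
  symdeg f = (symdeg f - Xdeg m + \sum_(i <- finsupp m) i.+1 * m i)%N.
Proof.
move=> mf; rewrite -[LHS](subnK (Xdeg_le mf)); congr (_ + _)%N.
by apply: eq_bigr => i _; rewrite mulnC.
Qed.

Lemma represents_homog_value (B : comNzRingType) (iota : {rmorphism R -> B})
    (n K : nat) (x0 : B) (x : 'I_n -> B) (s : B) :
  s ^+ 2 = x0 ^+ 2 + \sum_i x i ^+ 2 ->
  represents iota (weight iota x0 x s : letter n K -> B) s (excess K) predT
    (symdeg f) coef_sum
    (fun t => homog_value idfun (sign0 t) (fun i => block_powersum i.+1 t))
    (homog_value iota x0 (fun i => \sum_j x j ^+ i.+1)).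
Proof.
move=> sphere; apply: represents_sum => m mf.
have wsum := weight_sum iota K sphere.
have -> : `|f@_m| = `|f@_m| * 1 by rewrite mulr1.
apply: (representsZ (f@_m) (Phi := fun t =>
  homog_monomial (sign0 t) (fun i => block_powersum i.+1 t) m)).
rewrite (deg_split mf).
have r1 := representsX wsum (symdeg f - Xdeg m) (represents_sign0 iota K sphere).
have r2 : represents iota (weight iota x0 x s : letter n K -> B) s (excess K)
   predT (\sum_(i <- finsupp m) i.+1 * m i)%N 1
   (fun t => \prod_(i <- finsupp m) block_powersum i.+1 t ^+ m i)
   (\prod_(i <- finsupp m) (\sum_j x j ^+ i.+1) ^+ m i).
  apply: represents_prod => // i im.
  rewrite -[X in represents _ _ _ _ _ _ X](expr1n _ (m i)).
  apply: representsX => //; apply: represents_block_powersum => //.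
  exact: supp_gt0 mf im.
apply: (represents_conv (representsM r1 r2)) => //; first by rewrite mul1n.
by rewrite expr1n mulr1.
Qed.

Lemma homog_value_close (rho y0 z0 : R) (p r : nat -> R) : 0 <= rho ->
  close rho 1 y0 z0 -> (forall i, (0 < i)%N -> close rho 1 (p i) (r i)) ->
  homog_value idfun z0 r - coef_sum * ((symdeg f)%:R * rho) <=
  homog_value idfun y0 p.
Proof.
move=> rho0 yz pr; rewrite lerBlDr -lerBlDl /homog_value -sumrB /coef_sum mulr_suml.
rewrite big_seq [leRHS]big_seq; apply: ler_sum => m mf /=.
rewrite -mulrBr; apply: le_trans (ler_norm _) _; rewrite normrM ler_wpM2l //.
have cm : close rho (symdeg f - Xdeg m + \sum_(i <- finsupp m) i.+1 * m i)
   (homog_monomial y0 p m) (homog_monomial z0 r m).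
  rewrite -[X in (X + _)%N]mul1n; apply: closeM; first exact: closeX.
  apply: close_prod => i im; apply: closeX.
  by apply: close_weaken (pr i (supp_gt0 mf im)).
by move: cm; rewrite -deg_split // => -[_ _]; rewrite distrC.
Qed.

End HomogeneousValue.

(** * The certificate, uniform in the number of variables *)

Section Certificate.
Variables (R : realType) (f : symfun R) (eps : R).
Hypotheses (eps_gt0 : 0 < eps) (f_p1_free : p1_free f).
Hypothesis f_ge_eps : forall n (r0 : R) (r : 'I_n -> R),
  r0 ^+ 2 + \sum_i r i ^+ 2 = 1 ->
  eps <= homog_value f idfun r0 (fun i => \sum_j r j ^+ i.+1).

Let L : R := coef_sum f * (symdeg f)%:R.

Let L_ge0 : 0 <= L.
Proof. by rewrite mulr_ge0 ?ler0n // sumr_ge0. Qed.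

Let delta : R := eps / (5 * (L + 1)).

Let delta_gt0 : 0 < delta.
Proof. by rewrite divr_gt0 // mulr_gt0 // ltr_wpDl. Qed.

Let K : nat := Num.bound (delta ^- 2).

Let K_large : K.+2%:R^-1 <= delta ^+ 2.
Proof.
have d2 : 0 < delta ^+ 2 by rewrite exprn_gt0.
rewrite -[leRHS]invrK lef_pV2 ?posrE ?invr_gt0 ?ltr0n //.
have := archi_boundP (ltW (eqbRL (invr_gt0 (delta ^+ 2)) d2)).
by move=> /ltW /le_trans; apply; rewrite ler_nat; exact: leq_trans (leqnSn _) (leqnSn _).
Qed.

Let c0 := L / delta ^+ 3.
Let c1 := L * (8 / delta ^+ 9).
Let c2 := L * (2 * delta)^-1.

(** The coefficients are those of the penalties in the bounds on the rounding
    errors, multiplied by the Lipschitz constant L. *)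
Definition penalized n (t : letter n K -> R) : R :=
  homog_value f idfun (sign0 t) (fun i => block_powersum i.+1 t) +
  (c0 * penalty0 t + c1 * penalty1 t + c2 * penalty2 t).

Lemma penalized_ge n (t : letter n K -> R) : simplex t -> eps / 2 <= penalized t.
Proof.
move=> st.
have gap0 := rounded0_gap st delta_gt0.
have gap1 := sum_rounded_gap st delta_gt0 K_large.
set rho := 5 / 2 * delta + (delta ^+ 3)^-1 * penalty0 t +
   8 / delta ^+ 9 * penalty1 t + (2 * delta)^-1 * penalty2 t.
have err0 : 0 <= \sum_i `|drift i t - rounded t i * mass i t| by apply: sumr_ge0.
have err1 : 0 <= `|sign0 t - rounded0 t| by [].
have rho0 : 0 <= rho by rewrite /rho; lra.
have := f_ge_eps (rounded_sphere st).
have : close rho 1 (sign0 t) (rounded0 t).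
  split; [exact: normr_sign0|exact: normr_rounded0|rewrite mul1r /rho; lra].
have pow i : (0 < i)%N ->
    close rho 1 (block_powersum i.+1 t) (\sum_j rounded t j ^+ i.+1).
  move=> i0; split; [exact: normr_block_powersum|exact: normr_sum_rounded|].
  rewrite mul1r; apply: le_trans (block_powersum_gap st _) _ => //.
  by rewrite /rho; lra.
move=> /(homog_value_close f_p1_free rho0)/(_ pow).
rewrite mulrA -/L /penalized => le1 le2.
have E : L * rho = L * (5 / 2 * delta) +
    (c0 * penalty0 t + c1 * penalty1 t + c2 * penalty2 t).
  by rewrite /rho /c0 /c1 /c2; ring.
have Ld : L * (5 / 2 * delta) <= eps / 2.
  have L1 : L + 1 != 0 by rewrite gt_eqF // ltr_wpDl.
  have -> : L * (5 / 2 * delta) = eps / 2 * (L / (L + 1)) by rewrite /delta; field.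
  rewrite -[leRHS]mulr1 ler_wpM2l ?divr_ge0 ?(ltW eps_gt0) //.
  by rewrite ler_pdivrMr ?ltr_wpDl // mul1r lerDl.
lra.
Qed.

Let d : nat := (symdeg f + 12)%N.
Let C : R := coef_sum f + 4 * (c0 + c1 + c2).

Lemma represents_penalized n (B : comNzRingType) (iota : {rmorphism R -> B})
    (x0 : B) (x : 'I_n -> B) (s : B) :
  s ^+ 2 = x0 ^+ 2 + \sum_i x i ^+ 2 ->
  represents iota (weight iota x0 x s : letter n K -> B) s (excess K) predT d C
    (@penalized n)
    (homog_value f iota x0 (fun i => \sum_j x j ^+ i.+1) * s ^+ 12).
Proof.
move=> sphere; have wsum := weight_sum iota K sphere.
have pad := represents1 iota wsum.
(* The degree symdeg f + 12 accommodates the second penalty, of degree 12. *)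
have rf := representsM (represents_homog_value f_p1_free iota K sphere) (pad 12).
have r0 := representsM (represents_penalty0 iota K sphere) (pad (symdeg f + 8)%N).
have r1 := representsM (represents_penalty1 iota K sphere) (pad (symdeg f)).
have r2 := representsM (represents_penalty2 iota K sphere) (pad (symdeg f + 8)%N).
have e1 : (4 + (symdeg f + 8) = d)%N by rewrite /d; lia.
have e2 : (12 + symdeg f = d)%N by rewrite /d; lia.
rewrite e1 in r0 r2; rewrite e2 in r1.
have r := representsD rf (representsD (representsD (representsZ c0 r0)
   (representsZ c1 r1)) (representsZ c2 r2)).
apply: (represents_conv r) => //.
- have h0 : 0 <= c0 by rewrite divr_ge0 // exprn_ge0 // ltW.
  have h1 : 0 <= c1 by rewrite mulr_ge0 // divr_ge0 // exprn_ge0 // ltW.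
  have h2 : 0 <= c2 by rewrite mulr_ge0 // invr_ge0 mulr_ge0 // ltW.
  by rewrite !ger0_norm // /C; lra.
- by move=> t _; rewrite /penalized !mulr1.
by rewrite !mul0r !mulr0 !addr0.
Qed.

(** The exponent e is produced before n: it depends on f and eps only. Its
    parity is that of the degree, because [excess] is odd. *)
Lemma homog_value_sos : exists2 e : nat, odd e = odd (symdeg f) &
  forall n (B : comNzRingType) (iota : {rmorphism R -> B})
    (x0 : B) (x : 'I_n -> B) (s : B),
  s ^+ 2 = x0 ^+ 2 + \sum_i x i ^+ 2 ->
  is_sos (s ^+ e * homog_value f iota x0 (fun i => \sum_j x j ^+ i.+1)).
Proof.
pose M := (d + Num.bound (C * (d ^ 2)%:R / (eps / 2))).+1.
exists ((excess K).+1 * (M - d) + excess K * d + 12)%N.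
  have oK : odd (excess K) by rewrite /excess; lia.
  move: (excess K) (M - d)%N oK => a b oa.
  by rewrite !oddD !oddM /= oa /= addbF addbb /d oddD addbF.
move=> n B iota x0 x s sphere.
have rep := represents_penalized iota sphere.
have C0 := represents_pos rep.
have [g [gC _ gt gtau]] := rep.
have := polya (d := d) (M := M) (eps := eps / 2) (t := weight iota x0 x s)
  iota (fun u => le_trans (ler_norm _) (gC u)) C0.
rewrite gtau (weight_sum iota K sphere) => H.
rewrite (_ : _ * _ = (s ^+ (excess K).+1) ^+ (M - d) *
   (s ^+ (excess K * d) *
    (homog_value f iota x0 (fun i => \sum_j x j ^+ i.+1) * s ^+ 12))).
  apply: H => //.
  - by move=> r sr; rewrite gt // penalized_ge.
  - by apply: leqW; exact: leq_addr.
  - have e2 : 0 < eps / 2 by rewrite divr_gt0.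
    rewrite [leRHS]mulrC -ler_pdivrMr //.
    have q0 : 0 <= C * (d ^ 2)%:R / (eps / 2).
      by apply: divr_ge0 (mulr_ge0 C0 (ler0n _ _)) (ltW e2).
    move/ltW/le_trans: (archi_boundP q0); apply.
    by rewrite ler_nat; apply: leqW; exact: leq_addl.
  by move=> w; apply: sos_weight.
rewrite -exprM; move: (_ * (M - d))%N (excess K * d)%N (homog_value _ _ _ _) => a b h.
by rewrite exprD [s ^+ (a + b)]exprD; ring.
Qed.

End Certificate.

(** * The theorem *)

Lemma truncation_sphere_exp (R : realType) n k (f : symfun R) :
  truncation n ((1 + powersum R 2) ^+ k * f) =
  (1 + \sum_(j < n) mpolyX R (mnm1 j) ^+ 2) ^+ k * truncation n f.
Proof.
rewrite rmorphM rmorphXn; congr (_ ^+ k * _).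
rewrite -(@truncation_powersum R n 2) // -(rmorph1 (@truncation R n)).
exact: (rmorphD (@truncation R n)).
Qed.

Lemma finseq_of_family (R : realType) n (r : 'I_n -> R) :
  exists y : finseq R, forall k,
    \sum_(j <- finsupp y) y j ^+ k.+1 = \sum_i r i ^+ k.+1.
Proof.
pose S := [fset val i | i in 'I_n]%fset.
pose y : finseq R := [fsfun j in S => oapp r 0 (insub j)].
have yE (i : 'I_n) : y i = r i.
  by rewrite fsfunE ifT ?valK //; apply/imfsetP; exists i.
exists y => k; transitivity (\sum_(j <- S) y j ^+ k.+1).
  apply: big_fset_incl; first exact: finsupp_sub.
  by move=> j _ jy; rewrite fsfun_dflt // expr0n.
rewrite big_imfset /=; last by move=> i j _ _; exact: val_inj.
by rewrite big_enum; apply: eq_bigr => i _; rewrite yE.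
Qed.

Theorem theorem5p1 (R : realType) (eps : R) (f : symfun R)
    (eps_gt0 : 0 < eps) (f_p1_free : p1_free f)
    (fh_ge_eps : forall (x0 : R) (x : finseq R),
        x0 ^+ 2 + symeval x (powersum R 2) = 1 ->
        eps <= eval_homog (homogenization f) x0 x) :
  exists k : nat, anydim_sos ((1 + powersum R 2) ^+ k * f).
Proof.
have f_ge n (r0 : R) (r : 'I_n -> R) : r0 ^+ 2 + \sum_i r i ^+ 2 = 1 ->
    eps <= homog_value f idfun r0 (fun i => \sum_j r j ^+ i.+1).
  have [y yE] := finseq_of_family r => sph.
  have := fh_ge_eps r0 y; rewrite symeval_powersum // yE => /(_ sph).
  rewrite eval_homog_value; congr (_ <= _).
  by congr homog_value; apply/funext => i; rewrite yE.
have [e oe sosf] := homog_value_sos eps_gt0 f_p1_free f_ge.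
(* Otherwise the homogenization takes opposite values at (1, 0) and (-1, 0). *)
have De : ~~ odd (symdeg f).
  apply/negP => oD.
  have nul (r : 'I_0 -> R) i : \sum_j r j ^+ i.+1 = 0 by rewrite big_ord0.
  have := f_ge 0%N (-1) (fun=> 0); have := f_ge 0%N 1 (fun=> 0).
  rewrite (homog_value_odd (nul _)) // !big_ord0 !addr0 sqrrN !expr1n.
  by move=> /(_ erefl) h /(_ erefl) h'; lra.
exists e./2 => n _.
pose X (j : 'I_n) := mpolyX R (mnm1 j).
pose q : mpoly n R := 1 + \sum_j X j ^+ 2.
have sosq : is_sos q.
  by apply: sosD; [exact: sos1|apply: sos_sum => j _; exact: sos_sqr].
apply: (sos_sqrt_ext sosq).
have sphere : sqrt_gen q ^+ 2 = 1 ^+ 2 + \sum_j sqrt_ext_in q (X j) ^+ 2.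
  rewrite sqrt_gen_sqr rmorphD rmorph1 expr1n rmorph_sum; congr (_ + _).
  by apply: eq_bigr => j _; rewrite rmorphXn.
have := sosf n _ (sqrt_ext_in q \o @mpolyC n R) _ _ _ sphere.
rewrite -truncation_value.
have {1}-> : e = (2 * e./2)%N by move: De; rewrite -oe; lia.
rewrite truncation_sphere_exp.
by rewrite (sqrt_gen_even q).
Qed.
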